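(* Let $\beta>0$, and for each $n\ge2$ let $m(n)$ be an integer with $1\le m(n)\le n-1$. For each $n\ge 2$ let $(Z^{(n,0)}_k)_{1\le k\le n}$ be a random family of points in $\mathbb{C}$, and let $(Z^{(n,j)}_k)_{1\le k\le n-j}$, $1\le j\le m(n)$, be the zeros of its iterated randomized derivatives with parameter $\beta$, with empirical measures $\mu_{n,j}=\frac1{n-j}\sum_{k=1}^{n-j}\delta_{Z^{(n,j)}_k}$, $0\le j\le m(n)$ (as defined in the context). Assume that $(\mu_{n,0})_{n\ge 2}$ converges almost surely to a deterministic measure $\mu$ on $\mathbb{C}$, that $$\frac{m(n)}{n/\log n}\underset{n\to\infty}{\longrightarrow}0,$$ and that for some $B\ge0$, $$\sup_{n\ge2}n^{-B}\sup_{0\le j\le m(n)-1}\mathbb{E}\left[\min_{1\le k\le n-j}|Z^{(n,j)}_k|\right]<\infty.$$ Then $(\mu_{n,m(n)})_{n\ge2}$ converges almost surely to $\mu$.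
   Context: All random variables are defined on one probability space. The Gamma distribution of parameter $\beta/2$ has density $\frac{1}{\Gamma(\beta/2)}t^{\beta/2-1}e^{-t}$ on $(0,\infty)$. Iterated randomized derivatives: for each $n\ge2$, let $(\gamma^{(n,j)}_k)_{1\le j\le m(n),\,1\le k\le n+1-j}$ be i.i.d. Gamma random variables of parameter $\beta/2$, independent of $(Z^{(n,0)}_k)_{1\le k\le n}$. Inductively for $1\le j\le m(n)$, $(Z^{(n,j)}_k)_{1\le k\le n-j}$ are the zeros, counted with multiplicity, of the polynomial $$z\mapsto\sum_{k=1}^{n+1-j}\gamma^{(n,j)}_k\prod_{1\le\ell\le n+1-j,\ \ell\ne k}(z-Z^{(n,j-1)}_\ell),$$ which almost surely has degree $n-j$. The zeros are labelled in some measurable way depending only on $(Z^{(n,j-1)}_\ell)_\ell$ and $(\gamma^{(n,j)}_k)_k$, so that $(\gamma^{(n,j)}_k)_{1\le k\le n+1-j}$ is independent of $(Z^{(n,j-1)}_\ell)_{1\le\ell\le n+1-j}$. Almost sure convergence of random probability measures means that, almost surely, the sequence converges weakly (tested against bounded continuous functions on $\mathbb{C}$). *)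

(* Defs.v *)
From HB Require Import structures.
From mathcomp Require Import all_boot all_order all_algebra finmap.
From mathcomp Require Import all_classical all_reals all_analysis.
From mathcomp Require Import complex.

Set Implicit Arguments.
Unset Strict Implicit.
Unset Printing Implicit Defensive.

Import Order.TTheory GRing.Theory Num.Theory.
Import numFieldNormedType.Exports.

Local Open Scope classical_set_scope.
Local Open Scope ring_scope.

(* The complex numbers with their Borel sigma-algebra; convertible to R[i].
   The topology induced by the modulus is carried by the alias R[i]^o. *)
Notation borelC R := (g_sigma_algebraType (@open R[i]^o)).

(* Real-valued modulus (the norm `|z| of R[i] is itself an element of R[i]). *)
Notation modulus := (@Normc.normc _).

Section independence.
Context d (Omega : measurableType d) (R : realType) (P : probability Omega R).

Definition mutually_independent d' (T : measurableType d') (I : choiceType)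
    (D : set I) (X : I -> Omega -> T) : Prop :=
  forall J : {fset I}, [set` J] `<=` D ->
  forall A : I -> set T, (forall i, measurable (A i)) ->
    P (\bigcap_(i in [set` J]) (X i @^-1` A i)) =
    (\prod_(i <- J) P (X i @^-1` A i))%E.

Definition sigma_generated d' (T : measurableType d') (I : Type)
    (D : set I) (X : I -> Omega -> T) : set (set Omega) :=
  <<s \bigcup_(i in D) g_sigma_algebra_preimage (X i) >>.

Definition independent_sigma (F G : set (set Omega)) : Prop :=
  forall A B, F A -> G B -> P (A `&` B) = (P A * P B)%E.

End independence.

Section gamma_law.
Context (R : realType).

Definition Gamma (a : R) : R :=
  Rintegral lebesgue_measure `]0, +oo[ (fun t => t `^ (a - 1) * expR (- t)).

Definition gamma_pdf (a t : R) : R :=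
  if 0 < t then t `^ (a - 1) * expR (- t) / Gamma a else 0.

Definition gamma_distributed d (Omega : measurableType d)
    (P : probability Omega R) (a : R) (X : Omega -> R) : Prop :=
  measurable_fun setT X /\
  forall A : set R, measurable A ->
    P (X @^-1` A) = (\int[lebesgue_measure]_(t in A) (gamma_pdf a t)%:E)%E.

End gamma_law.

Section point_configurations.
Context (R : realType).
Implicit Types z : seq R[i].

Definition randomized_derivative (g : seq R) z : {poly R[i]} :=
  \sum_(k < size z) (g`_k)%:C%C *:
    \prod_(l < size z | l != k) ('X - (z`_l)%:P).

Definition zeros_with_multiplicity (p : {poly R[i]}) z : Prop :=
  p != 0 /\ forall x : R[i], count_mem x z = mup x p.

(* The minimum over a nonempty z; the seed is one of the competing values. *)
Definition min_modulus z : R :=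
  \big[Num.min/modulus (head 0 z)]_(x <- z) modulus x.

Definition empirical_measure z : {measure set (borelC R) -> \bar R} :=
  mscale ((size z)%:R^-1)%:nng
    (msum (fun k => \d_(z`_k : borelC R)) (size z)).

Definition cvg_weakly (mu_ : nat -> {measure set (borelC R) -> \bar R})
    (mu : {measure set (borelC R) -> \bar R}) : Prop :=
  forall f : R[i]^o -> R, continuous f -> (exists M : R, forall x, `|f x| <= M) ->
    (\int[mu_ n]_x (f x)%:E)%E @[n --> \oo] --> (\int[mu]_x (f x)%:E)%E.

End point_configurations.

Section iterated_randomized_derivatives.
Context (R : realType) (d : measure_display) (Omega : measurableType d).
Context (P : probability Omega R).

Definition gamma_index (m : nat -> nat) (n : nat) : set (nat * nat) :=
  [set jk | (1 <= jk.1 <= m n)%N /\ (jk.2 < n.+1 - jk.1)%N].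

Definition gamma_entry (gamma : forall n j, Omega -> (n.+1 - j).-tuple R)
    (n : nat) (jk : nat * nat) (w : Omega) : R :=
  (gamma n jk.1 w)`_jk.2.

(* Entries are numbered from 0: tnth (Z n j w) k is the (k+1)-st point of the
   j-th configuration at level n.  The step from j to j + 1 uses the weights
   gamma n j.+1, whose number n.+1 - j.+1 is convertible to n - j.  Nothing is
   assumed for n < 2, for j > m n, or on gamma n 0. *)
Record iterated_randomized_derivatives (beta : R) (m : nat -> nat)
    (gamma : forall n j, Omega -> (n.+1 - j).-tuple R)
    (Z : forall n j, Omega -> (n - j).-tuple (borelC R)) : Prop := {
  Z_measurable : forall n j, (2 <= n)%N -> (j <= m n)%N ->
    measurable_fun setT (Z n j) ;
  gamma_law : forall n jk, (2 <= n)%N -> gamma_index m n jk ->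
    gamma_distributed P (beta / 2) (gamma_entry gamma n jk) ;
  gamma_independent : forall n, (2 <= n)%N ->
    mutually_independent P (gamma_index m n) (gamma_entry gamma n) ;
  gamma_indep_Z0 : forall n, (2 <= n)%N ->
    independent_sigma P
      (sigma_generated (gamma_index m n) (gamma_entry gamma n))
      (g_sigma_algebra_preimage (Z n 0%N)) ;
  Z_zeros : forall n j, (2 <= n)%N -> (j < m n)%N ->
    {ae P, forall w, zeros_with_multiplicity
      (randomized_derivative (gamma n j.+1 w) (Z n j w)) (Z n j.+1 w)} ;
  (* The zeros are labelled measurably, depending only on the previous zeros
     and on the weights; as they exist only almost surely, so does the label
     identity. *)
  Z_labelling : forall n j, (2 <= n)%N -> (j < m n)%N ->
    exists lab : (n - j).-tuple (borelC R) * (n - j).-tuple R ->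
                 (n - j.+1).-tuple (borelC R),
      measurable_fun setT lab /\
      {ae P, forall w, Z n j.+1 w = lab (Z n j w, gamma n j.+1 w)} }.

End iterated_randomized_derivatives.

(* Main.v *)
Require Import Defs.
From HB Require Import structures.
From mathcomp Require Import all_boot all_order all_algebra finmap.
From mathcomp Require Import all_classical all_reals all_analysis.
From mathcomp Require Import measurable_realfun.
From mathcomp Require Import complex.
From mathcomp Require Import zify ring lra.

Set Implicit Arguments.
Unset Strict Implicit.
Unset Printing Implicit Defensive.

Import Order.TTheory GRing.Theory Num.Theory.
Import numFieldNormedType.Exports.

Local Open Scope classical_set_scope.
Local Open Scope ring_scope.

(** One step replaces points z_1, ..., z_N by the zeros w of
    Q = sum_k g_k prod_(l <> k) (X - z_l).  With P = prod (X - z_l) and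
    S = sum g_k, for every x apart from these points,

      sum_w log |x - w| - sum_l log |x - z_l| = log (|F(x)| / S),
      F(x) = Q(x) / P(x) = sum_k g_k / (x - z_k).

    Averaged over x on a circle of center c and radius r, the left side becomes
    the change of the sum of log max(|a - c|, r) over the points a.  If
    log (|F| / S) is O(log n) on the circle, then m(n) steps change the sum of
    this potential by O(m(n) log n) = o(n), so the averages over the initial and
    final points have the same limit.  Differences of two such potentials with
    the same center are bumps with compact support, and bumps suffice to
    recover every bounded continuous test function.

    The circle is replaced by the n roots x of (x - c)^n = b, where b is chosen
    among 2n values so that no root is too close to the z_l or to the w
    (exists_level_away): the product of a - x over the roots is (a - c)^n - b,
    so that neither Jensen's formula nor any integral is needed
    (grid_mean_logmax).  The distance to the poles bounds |F| / S from above.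

    The lower bound is probabilistic.  For a fixed x, let z_k have modulus at
    most n^(B'), where B' >= B + 3; by the moment assumption and Markov's
    inequality, z_k exists outside an event of probability O(n^-3).  Then
    (x - z_k) F(x) has real part g_k + V, where V is a function of the other
    weights and of the earlier steps, hence independent of g_k.  Since the Gamma law gives mass O(h^al) to
    intervals of length h, |g_k + V| is polynomially small only with
    polynomially small probability (small_ball_independent,
    weight_small_ball).  A union bound over x, k and the steps, followed by
    Borel-Cantelli, gives logmax_sums_close.

    The deterministic end is gap_iterate: a positive test function with compact
    support is approximated by sums of bumps over a lattice, each of which
    removes a fixed proportion of its supremum.  Taking rational centers and
    radii keeps the exceptional null sets countable, and a bump of large radius
    transfers the tightness of the initial measures to the final ones
    (cvg_weakly_zm). *)

(** * The modulus of a complex number *)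

Section Modulus.
Context {R : realType}.
Implicit Types x y z a : R[i].
Local Notation nc := (@Normc.normc R).

Lemma modulus_ge0 a : 0 <= nc a.
Proof. by case: a => x y /=; rewrite sqrtr_ge0. Qed.

Lemma modulus_eq0 a : (nc a == 0) = (a == 0).
Proof.
by apply/eqP/eqP => [/Normc.eq0_normc//|->]; rewrite Normc.normc0.
Qed.

Lemma modulus_gt0 a : (0 < nc a) = (a != 0).
Proof. by rewrite lt_neqAle modulus_ge0 andbT eq_sym modulus_eq0. Qed.

Lemma modulusN a : nc (- a) = nc a.
Proof. exact: normcN. Qed.

Lemma modulusD_le x y : nc (x + y) <= nc x + nc y.
Proof. exact: le_normcD. Qed.

Lemma modulus_distC x y : nc (x - y) = nc (y - x).
Proof. by rewrite -modulusN opprB. Qed.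

Lemma modulus_dist_dist x y : nc x - nc y <= nc (x - y).
Proof. by rewrite lerBlDr (le_trans _ (modulusD_le _ _))// subrK. Qed.

Lemma modulusX a n : nc (a ^+ n) = nc a ^+ n.
Proof.
elim: n => [|n IH]; first by rewrite !expr0 Normc.normc1.
by rewrite !exprS Normc.normcM IH.
Qed.

Lemma modulus_prod (I : Type) (s : seq I) (Q : pred I) (f : I -> R[i]) :
  nc (\prod_(i <- s | Q i) f i) = \prod_(i <- s | Q i) nc (f i).
Proof.
by apply: (big_morph nc); [exact: Normc.normcM|exact: Normc.normc1].
Qed.

Lemma modulus_sum_le (I : Type) (s : seq I) (Q : pred I) (f : I -> R[i]) :
  nc (\sum_(i <- s | Q i) f i) <= \sum_(i <- s | Q i) nc (f i).
Proof.
elim/big_ind2 : _ => //; first by rewrite Normc.normc0.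
move=> a1 b1 a2 b2 h1 h2; apply: (le_trans (modulusD_le _ _)).
exact: lerD.
Qed.

Lemma modulus_real (t : R) : nc t%:C%C = `|t|.
Proof. by rewrite /= expr0n addr0 sqrtr_sqr. Qed.

Lemma le_Re_modulus a : `|complex.Re a| <= nc a.
Proof.
case: a => u v /=; rewrite -sqrtr_sqr ler_wsqrtr// lerDl; exact: sqr_ge0.
Qed.

Lemma le_Im_modulus a : `|complex.Im a| <= nc a.
Proof.
case: a => u v /=; rewrite -sqrtr_sqr ler_wsqrtr// lerDr; exact: sqr_ge0.
Qed.

Lemma ln_prod (I : eqType) (s : seq I) (f : I -> R) :
  (forall i, i \in s -> 0 < f i) ->
  ln (\prod_(i <- s) f i) = \sum_(i <- s) ln (f i).
Proof.
elim: s => [|a s IH] h; first by rewrite !big_nil ln1.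
rewrite !big_cons lnM ?IH//.
- by move=> i si; apply: h; rewrite inE si orbT.
- by rewrite posrE h// mem_head.
- rewrite posrE big_seq; apply: prodr_gt0 => i si.
  by apply: h; rewrite inE si orbT.
Qed.

End Modulus.

(** * Equally spaced points near a circle *)

Section Grid.
Context {R : realType}.
Implicit Types x z a c : R[i].
Local Notation nc := (@Normc.normc R).

Definition poly_roots (p : {poly R[i]}) : seq R[i] :=
  projT1 (closed_field_poly_normal p).

(** The points of [grid c r n k] solve (x - c)^n = level r n k, so the product
    of a - x over the grid is the polynomial (a - c)^n - level r n k: its
    logarithm is a discretization, with no integral, of the mean of log |a - x|
    over a circle.  The spare parameter k moves the circle a little, which is
    how grid points are kept away from finitely many given points. *)
Definition level (r : R) (n k : nat) : R := r ^+ n * (1 + k%:R / n.*2%:R).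

Definition grid c (r : R) (n k : nat) : seq R[i] :=
  poly_roots (('X - c%:P) ^+ n - (level r n k)%:C%C%:P).

Lemma poly_rootsE (p : {poly R[i]}) : p \is monic ->
  p = \prod_(x <- poly_roots p) ('X - x%:P).
Proof.
rewrite /poly_roots monicE; case: closed_field_poly_normal => s /= ps /eqP lp.
by rewrite {1}ps lp scale1r.
Qed.

Lemma grid_poly_lt c (b : R[i]) n : (0 < n)%N ->
  (size (- b%:P : {poly R[i]}) < size (('X - c%:P) ^+ n))%N.
Proof.
move=> n0; rewrite size_polyN size_exp_XsubC.
by rewrite (leq_ltn_trans (size_polyC_leq1 _)).
Qed.

Lemma gridP c r n k : (0 < n)%N ->
  ('X - c%:P) ^+ n - (level r n k)%:C%C%:P =
  \prod_(x <- grid c r n k) ('X - x%:P).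
Proof.
move=> n0; apply: poly_rootsE; rewrite monicE lead_coefDl ?grid_poly_lt//.
by rewrite (eqP (monic_exp _ (monicXsubC c))).
Qed.

Lemma gridE c r n k a : (0 < n)%N ->
  (a - c) ^+ n - (level r n k)%:C%C = \prod_(x <- grid c r n k) (a - x).
Proof.
move=> n0; have := congr1 (horner ^~ a) (gridP c r k n0).
rewrite horner_prod !hornerE /= => ->.
by apply: eq_bigr => x _; rewrite !hornerE.
Qed.

Lemma size_grid c r n k : (0 < n)%N -> size (grid c r n k) = n.
Proof.
move=> n0; have := congr1 (size \o polyseq) (gridP c r k n0).
by rewrite /= size_prod_XsubC size_polyDl ?grid_poly_lt// size_exp_XsubC => -[].
Qed.

Lemma mem_grid c r n k x : (0 < n)%N -> x \in grid c r n k ->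
  (x - c) ^+ n = (level r n k)%:C%C.
Proof.
move=> n0 xs; apply/eqP; rewrite -subr_eq0 gridE//.
by rewrite prodf_seq_eq0; apply/hasP; exists x => //=; rewrite subrr.
Qed.

Lemma level_ge r n k : 0 < r -> r ^+ n <= level r n k.
Proof.
move=> r0; rewrite /level ler_peMr ?(exprn_ge0 _ (ltW r0))//.
by rewrite lerDl divr_ge0.
Qed.

Lemma level_le r n k : 0 < r -> (k < n.*2)%N -> level r n k <= 2 * r ^+ n.
Proof.
move=> r0 kn; rewrite /level mulrC ler_pM2r ?exprn_gt0//.
have -> : (2 : R) = 1 + 1 by [].
rewrite lerD2l ler_pdivrMr ?mul1r ?ler_nat 1?ltnW// ltr0n.
by rewrite (leq_trans _ kn).
Qed.

Lemma modulus_grid c r n k x : 0 < r -> (0 < n)%N -> (k < n.*2)%N ->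
  x \in grid c r n k -> nc (x - c) ^+ n = level r n k.
Proof.
move=> r0 n0 kn /(mem_grid n0) h.
rewrite -modulusX h modulus_real ger0_norm//.
by rewrite (le_trans _ (level_ge _ _ r0))// exprn_ge0// ltW.
Qed.

Lemma modulus_grid_le c r n k x : 0 < r -> (0 < n)%N -> (k < n.*2)%N ->
  x \in grid c r n k -> nc (x - c) <= 2 * r.
Proof.
move=> r0 n0 kn xg; have h := modulus_grid r0 n0 kn xg.
rewrite -(@ler_pXn2r _ n) ?nnegrE ?modulus_ge0 ?mulr_ge0 ?(ltW r0)//.
rewrite h (le_trans (level_le r0 kn))// exprMn ler_pM2r ?exprn_gt0//.
by rewrite ler_eXnr// ler1n.
Qed.

(** Pigeonhole: two levels differ by at least r^n / (2n), so that no point a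
    can be close to two of them; there are more levels than points. *)
Lemma exists_level_away (s : seq R[i]) c r n : 0 < r ->
  (size s < n.*2)%N ->
  exists2 k, (k < n.*2)%N & forall a, a \in s ->
    r ^+ n / (4 * n%:R) <= nc ((a - c) ^+ n - (level r n k)%:C%C).
Proof.
move=> r0 sn.
have n0 : (0 < n)%N by rewrite -double_gt0 (leq_trans _ sn).
apply: contrapT => H.
have {}H : forall k : 'I_n.*2, exists i : 'I_(size s),
    nc ((s`_i - c) ^+ n - (level r n k)%:C%C) < r ^+ n / (4 * n%:R).
  move=> k; apply: contrapT => H1; apply: H; exists k => // a /(nthP 0)[i si <-].
  by rewrite leNgt; apply/negP => h; apply: H1; exists (Ordinal si).
have [f fP] := choice H.
suff /leq_card : injective f by rewrite !card_ord leqNgt sn.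
move=> k l kl; apply/val_inj/eqP/negPn/negP => nkl.
have h1 := fP k; have h2 := fP l; rewrite -kl in h2.
set u := s`_(f k) in h1 h2.
have : nc ((level r n k)%:C%C - (level r n l)%:C%C) < r ^+ n / n.*2%:R.
  have -> : (level r n k)%:C%C - (level r n l)%:C%C =
    ((u - c) ^+ n - (level r n l)%:C%C) - ((u - c) ^+ n - (level r n k)%:C%C).
    by ring.
  apply: (le_lt_trans (modulusD_le _ _)); rewrite modulusN.
  apply: (lt_le_trans (ltrD h2 h1)).
  rewrite -mul2n natrM le_eqVlt; apply/orP; left; apply/eqP; field.
  by rewrite pnatr_eq0 -lt0n.
rewrite -rmorphB modulus_real /level -mulrBr normrM (gtr0_norm (exprn_gt0 _ r0)).
rewrite ltr_pM2l ?exprn_gt0// => {h1 h2}.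
have -> : 1 + k%:R / n.*2%:R - (1 + l%:R / n.*2%:R) = (k%:R - l%:R) / n.*2%:R :> R.
  by ring.
rewrite normrM normfV (ger0_norm (ler0n _ _)).
rewrite ltr_pdivrMr ?ltr0n ?double_gt0// mulVf ?pnatr_eq0 ?double_eq0 -?lt0n//.
apply/negP; rewrite -leNgt.
have := nkl; rewrite neq_ltn => /orP[] /= lt.
- rewrite ltr0_norm ?subr_lt0 ?ltr_nat// opprB -natrB ?ler1n ?subn_gt0//.
  exact: ltnW.
- rewrite gtr0_norm ?subr_gt0 ?ltr_nat// -natrB ?ler1n ?subn_gt0//.
  exact: ltnW.
Qed.

End Grid.

(** * The logarithmic potential of a circle *)

Section LogMax.
Context {R : realType}.
Implicit Types x z a c : R[i].
Local Notation nc := (@Normc.normc R).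

(** By Jensen's formula this is the mean of log |a - x| for x on the circle of
    center c and radius r. *)
Definition logmax c (r : R) a : R := ln (Num.max (nc (a - c)) r).

Lemma max_modulus_gt0 c (r : R) a : 0 < r -> 0 < Num.max (nc (a - c)) r.
Proof. by move=> r0; rewrite lt_max r0 orbT. Qed.

(** If |a - c|^n > 4 r^n then (a - c)^n dominates the level, which is at most
    2 r^n; otherwise r^n and the n-th power of the maximum are comparable and
    the hypothesis is the bound. *)
Lemma level_away_bounds c r n k a : 0 < r -> (k < n.*2)%N ->
  r ^+ n / (4 * n%:R) <= nc ((a - c) ^+ n - (level r n k)%:C%C) ->
  Num.max (nc (a - c)) r ^+ n / (16 * n%:R)
    <= nc ((a - c) ^+ n - (level r n k)%:C%C)
    <= 3 * Num.max (nc (a - c)) r ^+ n.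
Proof.
move=> r0 kn h.
have n0 : (0 < n)%N by rewrite -double_gt0 (leq_trans _ kn).
have n1 : 1 <= n%:R :> R by rewrite ler1n.
set m := Num.max _ _.
have m0 : 0 < m by exact: max_modulus_gt0.
have bl : nc (level r n k)%:C%C <= 2 * r ^+ n.
  rewrite modulus_real ger0_norm ?level_le//.
  by rewrite (le_trans _ (level_ge _ _ r0))// exprn_ge0// ltW.
have rm : r ^+ n <= m ^+ n.
  by rewrite lerXn2r ?nnegrE ?(ltW r0) ?(ltW m0)// /m le_max lexx orbT.
have am : nc (a - c) ^+ n <= m ^+ n.
  by rewrite lerXn2r ?nnegrE ?modulus_ge0 ?(ltW m0)// /m le_max lexx.
apply/andP; split; last first.
  apply: (le_trans (modulusD_le _ _)); rewrite modulusN modulusX.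
  lra.
have [ac|ac] := leP (nc (a - c) ^+ n) (4 * r ^+ n).
  apply: le_trans h.
  have -> : r ^+ n / (4 * n%:R) = 4 * r ^+ n / (16 * n%:R).
    by field; rewrite pnatr_eq0 -lt0n.
  rewrite ler_pM2r ?invr_gt0 ?mulr_gt0 ?ltr0n//.
  rewrite /m; case: (leP (nc (a - c)) r) => // _.
  by have := exprn_gt0 n r0; lra.
have -> : m ^+ n = nc (a - c) ^+ n.
  rewrite /m max_l// leNgt; apply/negP => acr.
  have : nc (a - c) ^+ n <= r ^+ n.
    by rewrite lerXn2r ?nnegrE ?modulus_ge0 ?(ltW r0)// ltW.
  by have := exprn_gt0 n r0; lra.
have := modulus_dist_dist ((a - c) ^+ n) (level r n k)%:C%C.
rewrite modulusX => h1.
apply: (@le_trans _ _ (nc (a - c) ^+ n / 2)); last by lra.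
rewrite ler_pM2l ?lef_pV2 ?posrE ?mulr_gt0 ?ltr0n//; last first.
  by have := exprn_gt0 n r0; lra.
lra.
Qed.

(** The error is of order log n / n, so that it contributes O(log n) once summed
    over at most n points. *)
Lemma grid_mean_logmax c r n k a : 0 < r -> (k < n.*2)%N ->
  r ^+ n / (4 * n%:R) <= nc ((a - c) ^+ n - (level r n k)%:C%C) ->
  `|(\sum_(x <- grid c r n k) ln (nc (a - x))) / n%:R - logmax c r a|
    <= ln (16 * n%:R) / n%:R.
Proof.
move=> r0 kn h.
have n0 : (0 < n)%N by rewrite -double_gt0 (leq_trans _ kn).
have n1 : 1 <= n%:R :> R by rewrite ler1n.
have m0 := max_modulus_gt0 c a r0.
have /andP[lo up] := level_away_bounds r0 kn h.
rewrite /logmax; set m := Num.max _ _ in m0 lo up *.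
have lo0 : 0 < m ^+ n / (16 * n%:R).
  by rewrite divr_gt0 ?exprn_gt0 ?mulr_gt0 ?ltr0n.
have u0 := lt_le_trans lo0 lo.
rewrite -ln_prod; last first.
  move=> x xg; rewrite modulus_gt0 subr_eq0; apply: contraTneq u0 => ->.
  by rewrite (mem_grid n0 xg) subrr Normc.normc0 ltxx.
rewrite -modulus_prod -gridE//.
set u := nc _ in u0 lo up *.
have -> : ln u / n%:R - ln m = (ln u - n%:R * ln m) / n%:R.
  by field; rewrite pnatr_eq0 -lt0n.
rewrite normrM normfV (ger0_norm (ler0n _ n)) ler_pM2r ?invr_gt0 ?ltr0n//.
rewrite mulr_natl -lnXn// ler_norml; apply/andP; split.
  rewrite lerBrDl -lnV ?posrE ?mulr_gt0 ?ltr0n// -lnM ?posrE ?exprn_gt0//.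
    by rewrite ler_ln ?posrE.
  by rewrite invr_gt0 mulr_gt0 ?ltr0n.
rewrite lerBlDl -lnM ?posrE ?exprn_gt0 ?mulr_gt0 ?ltr0n//.
rewrite ler_ln ?posrE ?mulr_gt0 ?exprn_gt0 ?ltr0n//.
apply: (le_trans up); rewrite mulrC ler_pM2l ?exprn_gt0//.
lra.
Qed.

(** (x - c)^n - (a - c)^n is x - a times a sum of n terms, each at most twice
    the power n - 1 of max(|a - c|, r). *)
Lemma grid_separated c r n k x a : 0 < r -> (k < n.*2)%N ->
  x \in grid c r n k ->
  r ^+ n / (4 * n%:R) <= nc ((a - c) ^+ n - (level r n k)%:C%C) ->
  r / (32 * n%:R ^+ 2) <= nc (x - a).
Proof.
move=> r0 kn xg h.
have n0 : (0 < n)%N by rewrite -double_gt0 (leq_trans _ kn).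
have n1 : 1 <= n%:R :> R by rewrite ler1n.
have m0 := max_modulus_gt0 c a r0.
have /andP[lo up] := level_away_bounds r0 kn h.
have ac : nc (a - c) <= Num.max (nc (a - c)) r by rewrite le_max lexx.
have rm : r <= Num.max (nc (a - c)) r by rewrite le_max lexx orbT.
set m := Num.max _ _ in m0 lo up ac rm *.
have xm : nc (x - c) ^+ n <= 2 * m ^+ n.
  rewrite (modulus_grid r0 n0 kn xg) (le_trans (level_le r0 kn))//.
  by rewrite ler_pM2l// lerXn2r ?nnegrE ?(ltW r0) ?(ltW m0).
set M := Num.max m (nc (x - c)).
have M0 : 0 <= M by rewrite le_max (ltW m0).
have Mm : M ^+ n.-1 <= 2 * m ^+ n.-1.
  rewrite /M; case: (leP (nc (x - c)) m) => [_|mx].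
    by have := exprn_gt0 n.-1 m0; lra.
  rewrite -(ler_pM2r m0) -mulrA -exprSr prednK//; apply: le_trans xm.
  rewrite -{2}(prednK n0) exprSr ler_wpM2l ?exprn_ge0 ?modulus_ge0//.
  exact: ltW.
have : nc ((a - c) ^+ n - (level r n k)%:C%C) <= nc (x - a) * (n%:R * (2 * m ^+ n.-1)).
  rewrite -(mem_grid n0 xg) modulus_distC subrXX Normc.normcM.
  rewrite opprB addrA subrK ler_wpM2l ?modulus_ge0// (le_trans (modulus_sum_le _ _ _))//.
  apply: (@le_trans _ _ (\sum_(i < n) 2 * m ^+ n.-1)); last first.
    by rewrite sumr_const card_ord [leRHS]mulr_natl.
  apply: ler_sum => i _; rewrite Normc.normcM !modulusX; apply: le_trans Mm.
  have ile : (i <= n.-1)%N by rewrite -ltnS prednK.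
  rewrite -[X in _ <= _ ^+ X](subnK ile) exprD.
  apply: ler_pM; rewrite ?exprn_ge0 ?modulus_ge0//.
    by rewrite lerXn2r ?nnegrE ?modulus_ge0// le_max ac.
  by rewrite lerXn2r ?nnegrE ?modulus_ge0// le_max lexx orbT.
move=> /(le_trans lo).
rewrite -{1}(prednK n0) exprS => h1.
have mn0 := exprn_gt0 n.-1 m0.
apply: (@le_trans _ _ (m / (32 * n%:R ^+ 2))).
  by rewrite ler_pM2r// invr_gt0 mulr_gt0// exprn_gt0// ltr0n.
rewrite -(@ler_pM2r _ (n%:R * (2 * m ^+ n.-1))); last first.
  by rewrite !mulr_gt0// ltr0n.
apply: le_trans h1; rewrite le_eqVlt; apply/orP; left; apply/eqP.
by field; rewrite pnatr_eq0 -lt0n.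
Qed.

End LogMax.

(** * Zeros and poles of a randomized derivative *)

Section RandomizedDerivative.
Context {R : realType}.
Implicit Types (x z a c : R[i]) (s w : seq R[i]) (g : seq R).
Local Notation nc := (@Normc.normc R).

(** The quotient of the randomized derivative by the product of the X - s_l. *)
Definition pole_sum g s x : R[i] :=
  \sum_(k < size s) (g`_k)%:C%C / (x - s`_k).

Lemma size_prod_XsubC_others s (k : 'I_(size s)) :
  size (\prod_(l < size s | l != k) ('X - (s`_l)%:P)) = size s.
Proof.
have s0 : (0 < size s)%N by exact: leq_ltn_trans (ltn_ord k).
rewrite size_prod; last by move=> i _; rewrite polyXsubC_eq0.
rewrite (eq_bigr (fun=> 2%N)); last by move=> i _; rewrite size_XsubC.
rewrite sum_nat_const cardC1 card_ord; lia.
Qed.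

Lemma coef_randomized_derivative g s :
  (randomized_derivative g s)`_(size s).-1 = (\sum_(k < size s) g`_k)%:C%C.
Proof.
rewrite /randomized_derivative coef_sum rmorph_sum.
apply: eq_bigr => k _; rewrite coefZ.
have : (\prod_(l < size s | l != k) ('X - (s`_l)%:P)) \is monic.
  by apply: monic_prod => i _; exact: monicXsubC.
by rewrite monicE lead_coefE size_prod_XsubC_others => /eqP ->; rewrite mulr1.
Qed.

Lemma horner_randomized_derivative g s x : x \notin s ->
  (randomized_derivative g s).[x] = pole_sum g s x * \prod_(a <- s) (x - a).
Proof.
move=> xs; rewrite /randomized_derivative horner_sum /pole_sum mulr_suml.
apply: eq_bigr => k _; rewrite hornerZ horner_prod.
rewrite [in RHS](big_nth 0) big_mkord [in RHS](bigD1 k)//= -mulrA; congr (_ * _).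
rewrite mulrA mulVf ?mul1r; last first.
  by rewrite subr_eq0; apply: contraNneq xs => ->; exact: mem_nth.
by apply: eq_bigr => i _; rewrite !hornerE.
Qed.

(** Counting degrees, a list of (size s).-1 zeros exhausts the polynomial; its
    leading coefficient is then the coefficient of that degree, the total
    weight. *)
Lemma randomized_derivative_zeros g s w :
  (0 < size s)%N -> size w = (size s).-1 ->
  zeros_with_multiplicity (randomized_derivative g s) w ->
  randomized_derivative g s =
  (\sum_(k < size s) g`_k)%:C%C *: \prod_(a <- w) ('X - a%:P).
Proof.
move=> s0 sw [p0 pw].
set p := randomized_derivative g s in p0 pw *.
have [rs prs] := closed_field_poly_normal p.
have lp : lead_coef p != 0 by rewrite lead_coef_eq0.
have wrs : perm_eq w rs.
  apply/allP => x _ /=; rewrite pw prs -mul_polyC mupMr ?mu_prod_XsubC//.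
  by rewrite rootC.
rewrite prs (perm_big _ wrs)/=; congr (_ *: _).
rewrite -coef_randomized_derivative// -/p lead_coefE; congr (_ `_ _).
rewrite prs size_scale// size_prod_XsubC -(perm_size wrs) sw.
by rewrite -pred_Sn.
Qed.

End RandomizedDerivative.

(** * Effect of one randomized derivative on the potentials *)

Section OneStep.
Context {R : realType}.
Implicit Types (x z a c : R[i]) (s w : seq R[i]) (g : seq R).
Local Notation nc := (@Normc.normc R).

Lemma pole_sum_le g s x (e : R) : 0 < e -> (forall k, 0 <= g`_k) ->
  (forall a, a \in s -> e <= nc (x - a)) ->
  nc (pole_sum g s x) <= (\sum_(k < size s) g`_k) / e.
Proof.
move=> e0 g0 h; rewrite mulr_suml (le_trans (modulus_sum_le _ _ _))//.
apply: ler_sum => k _; rewrite Normc.normcM Normc.normcV modulus_real.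
rewrite ger0_norm// ler_wpM2l// lef_pV2 ?posrE//; last first.
  by rewrite (lt_le_trans e0)// h// mem_nth.
by rewrite h// mem_nth.
Qed.

(** The total weight is the leading coefficient of the randomized derivative, so
    that pole_sum over total weight is the product of x - w over the zeros
    divided by the product of x - s over the poles. *)
Lemma ln_zeros_over_poles g s w x :
  (0 < size s)%N -> size w = (size s).-1 ->
  zeros_with_multiplicity (randomized_derivative g s) w ->
  0 < \sum_(k < size s) g`_k -> x \notin s -> x \notin w ->
  \sum_(a <- w) ln (nc (a - x)) - \sum_(a <- s) ln (nc (a - x)) =
  ln (nc (pole_sum g s x) / \sum_(k < size s) g`_k).
Proof.
move=> s0 sw pw S0 xs xw; set S := \sum_(k < size s) _ in S0 *.
have pos t : x \notin t -> forall a, a \in t -> 0 < nc (a - x).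
  by move=> xt a at_; rewrite modulus_gt0 subr_eq0; apply: contraNneq xt => <-.
have ppos t : x \notin t -> 0 < \prod_(a <- t) nc (a - x).
  by move=> xt; rewrite big_seq; apply: prodr_gt0 => a; exact: pos.
rewrite -!ln_prod; [|exact: pos..].
have E : nc (pole_sum g s x) / S * \prod_(a <- s) nc (a - x) =
    \prod_(a <- w) nc (a - x).
  have := horner_randomized_derivative g xs.
  rewrite (randomized_derivative_zeros s0 sw pw) hornerZ horner_prod.
  rewrite (eq_bigr (fun a => x - a)); last by move=> a _; rewrite !hornerE.
  move=> /(congr1 nc); rewrite !Normc.normcM modulus_real gtr0_norm//.
  rewrite !modulus_prod.
  under eq_bigr do rewrite modulus_distC.
  under [X in _ = _ * X -> _]eq_bigr do rewrite modulus_distC.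
  move=> H; apply: (mulfI (lt0r_neq0 S0)); rewrite H.
  by field; rewrite lt0r_neq0.
rewrite -E lnM ?posrE ?ppos ?addrK//.
rewrite -(pmulr_lgt0 _ (ppos _ xs)) E; exact: ppos.
Qed.

(** The sums of [logmax] over zeros and over poles differ by the mean over a grid
    of log |pole_sum / total weight|, up to the discretization error.  The
    quotient is bounded above because grid points stay away from the poles;
    the hypothesis with [eps] bounds it below, and is where randomness
    enters. *)
Lemma randomized_derivative_logmax c (r eps : R) (n : nat) g s w :
  0 < r -> (0 < size s <= n)%N -> size w = (size s).-1 ->
  (forall k, 0 <= g`_k) -> 0 < \sum_(k < size s) g`_k ->
  zeros_with_multiplicity (randomized_derivative g s) w ->
  0 < eps ->
  (forall k x, (k < n.*2)%N -> x \in grid c r n k -> x \notin s ->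
     eps * (\sum_(k < size s) g`_k) <= nc (pole_sum g s x)) ->
  `|\sum_(a <- w) logmax c r a - \sum_(a <- s) logmax c r a| <=
  `|ln eps| + `|ln (32 * n%:R ^+ 2 / r)| + 2 * ln (16 * n%:R).
Proof.
move=> r0 /andP[s0 sn] sw g0 S0 pw e0 H.
have n0 : (0 < n)%N by exact: leq_trans sn.
have n1 : 1 <= n%:R :> R by rewrite ler1n.
have nn : (n%:R : R) != 0 by rewrite pnatr_eq0 -lt0n.
have swlt : (size (s ++ w) < n.*2)%N.
  by rewrite size_cat sw -addnn; move: s0 sn; case: (size s) => // m _; lia.
have [k kn kP] := exists_level_away c r0 swlt.
pose X := grid c r n k.
pose psi a := (\sum_(x <- X) ln (nc (a - x))) / n%:R.
have psiP a : a \in s ++ w -> `|logmax c r a - psi a| <= ln (16 * n%:R) / n%:R.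
  by move=> /kP h; rewrite distrC; exact: grid_mean_logmax.
have l0 : 0 <= ln (16 * n%:R) :> R by rewrite ln_ge0//; lra.
have sumP t : (size t <= n)%N -> {subset t <= s ++ w} ->
    `|\sum_(a <- t) logmax c r a - \sum_(a <- t) psi a| <= ln (16 * n%:R).
  move=> tn tsw; rewrite -sumrB (le_trans (ler_norm_sum _ _ _))//.
  apply: (@le_trans _ _ (\sum_(a <- t) ln (16 * n%:R) / n%:R)).
    by rewrite big_seq [leRHS]big_seq; apply: ler_sum => a /tsw /psiP.
  rewrite big_const_seq count_predT iter_addr_0 -[leLHS]mulr_natr -mulrA.
  rewrite -[leRHS]mulr1 ler_wpM2l// mulrC ler_pdivrMr ?ltr0n// mul1r.
  by rewrite ler_nat.
have away x a : x \in X -> a \in s ++ w -> r / (32 * n%:R ^+ 2) <= nc (x - a).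
  by move=> xX /kP; exact: grid_separated.
have d0 : 0 < r / (32 * n%:R ^+ 2).
  by rewrite divr_gt0// mulr_gt0// exprn_gt0// ltr0n.
have notin x (t : seq R[i]) : x \in X -> {subset t <= s ++ w} -> x \notin t.
  move=> xX tsw; apply/negP => /tsw /(away _ _ xX).
  by rewrite subrr Normc.normc0 leNgt d0.
have ssw : {subset s <= s ++ w} by move=> a; rewrite mem_cat => ->.
have wsw : {subset w <= s ++ w} by move=> a; rewrite mem_cat orbC => ->.
have psiB : `|\sum_(a <- w) psi a - \sum_(a <- s) psi a| <=
    `|ln eps| + `|ln (32 * n%:R ^+ 2 / r)|.
  rewrite -!mulr_suml exchange_big [X in _ - X / _]exchange_big /= -mulrBl -sumrB.
  rewrite normrM normfV (ger0_norm (ler0n _ n)) ler_pdivrMr ?ltr0n//.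
  apply: (le_trans (ler_norm_sum _ _ _)).
  set A := `|_| + _.
  apply: (@le_trans _ _ (\sum_(x <- X) A)); last first.
    by rewrite big_const_seq count_predT iter_addr_0 size_grid// mulr_natr.
  rewrite big_seq [leRHS]big_seq; apply: ler_sum => x xX.
  rewrite (ln_zeros_over_poles s0 sw pw S0 (notin x s xX ssw) (notin x w xX wsw)).
  set S := \sum_(k < size s) _ in S0 H *.
  have lo : eps <= nc (pole_sum g s x) / S.
    by rewrite ler_pdivlMr// (H k)// notin.
  have up : nc (pole_sum g s x) / S <= 32 * n%:R ^+ 2 / r.
    rewrite ler_pdivrMr// mulrC (le_trans (pole_sum_le d0 g0 _))//.
      by move=> a /ssw; exact: away.
    rewrite invf_div//.
  have u0 := lt_le_trans e0 lo.
  rewrite /A; have lo' : ln eps <= ln (nc (pole_sum g s x) / S) by rewrite ler_ln ?posrE.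
  have up' : ln (nc (pole_sum g s x) / S) <= ln (32 * n%:R ^+ 2 / r).
    by rewrite ler_ln ?posrE// (lt_le_trans u0).
  rewrite ler_norml; apply/andP; split.
    by apply: le_trans lo'; have := ler_norm (- ln eps); rewrite normrN;
       have := normr_ge0 (ln (32 * n%:R ^+ 2 / r)); lra.
  by apply: (le_trans up'); have := ler_norm (ln (32 * n%:R ^+ 2 / r));
     have := normr_ge0 (ln eps); lra.
have h1 := sumP s sn ssw.
have h2 : `|\sum_(a <- w) logmax c r a - \sum_(a <- w) psi a| <= ln (16 * n%:R).
  by apply: sumP => //; rewrite sw (leq_trans (leq_pred _)).
move: h1 h2 psiB; rewrite !ler_norml => /andP[? ?] /andP[? ?] /andP[? ?].
apply/andP; split; lra.
Qed.

End OneStep.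

(** * Bounds for the Gamma law *)

Section GammaLaw.
Context {R : realType}.

(** With an integer N >= q and t > 1, t^N = N^N (t/N)^N <= N^N (exp (t/N))^N = N^N exp t. *)
Lemma powR_mul_expRN_bounded (q : R) : 0 <= q ->
  exists2 C : R, 0 < C & forall t, 0 < t -> t `^ q * expR (- t) <= C.
Proof.
move=> q0; have [N Nq] : exists N : nat, q <= N.+1%:R.
  exists (Num.trunc q); exact/ltW/truncnS_gt.
exists (1 + N.+1%:R ^+ N.+1) => [|t t0]; first by rewrite ltr_pwDl// exprn_ge0.
have [t1|t1] := leP t 1.
  apply: (@le_trans _ _ 1); last by rewrite lerDl exprn_ge0.
  rewrite -[leRHS]mulr1 ler_pM ?powR_ge0 ?expR_ge0//.
    apply: (@le_trans _ _ (1 `^ q)); last by rewrite powR1.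
    by rewrite ge0_ler_powR ?nnegrE// ltW.
  by rewrite -expR0 ler_expR oppr_le0 ltW.
apply: (@le_trans _ _ (N.+1%:R ^+ N.+1)); last by rewrite lerDr.
rewrite expRN -ler_pdivlMr ?invr_gt0 ?expR_gt0// invrK.
apply: (@le_trans _ _ (t ^+ N.+1)).
  by rewrite -powR_mulrn ?(ltW t0)// ler_powR// ltW.
have -> : t = (t / N.+1%:R) * N.+1%:R by rewrite divfK.
rewrite exprMn mulrC ler_wpM2l ?exprn_ge0// expRM_natr lerXn2r ?nnegrE ?expR_ge0//.
  by rewrite divr_ge0// ltW.
by apply: le_trans (expR_ge1Dx _); rewrite lerDr.
Qed.

Lemma powR_subadditive (al u h : R) : 0 < al -> al <= 1 -> 0 <= u -> 0 < h ->
  (u + h) `^ al - u `^ al <= h `^ al.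
Proof.
move=> al0 al1 u0 h0; have uh : 0 < u + h by lra.
have F (t : R) : 0 <= t -> t <= 1 -> t <= t `^ al.
  move=> t0 t1; have [->|tn0] := eqVneq t 0; first by rewrite powR_ge0.
  have tp : 0 < t by rewrite lt_neqAle eq_sym tn0.
  by rewrite -{1}(powRr1 t0) ger_powR// tp.
have E (t : R) : 0 <= t -> t `^ al = (t / (u + h)) `^ al * (u + h) `^ al.
  by move=> t0; rewrite -powRM ?divr_ge0 ?(ltW uh)// divfK ?gt_eqF.
rewrite (E u)// (E h) ?(ltW h0)// lerBlDr -mulrDl ler_peMl ?powR_ge0//.
apply: (@le_trans _ _ (h / (u + h) + u / (u + h))).
  by rewrite -mulrDl [h + u]addrC divff ?gt_eqF.
rewrite lerD// F ?divr_ge0 ?(ltW uh) ?(ltW h0)//.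
  by rewrite ler_pdivrMr// mul1r lerDr.
by rewrite ler_pdivrMr// mul1r lerDl ltW.
Qed.

Lemma integral_powR (s u v : R) : 0 < u -> u < v -> s != 0 ->
  (\int[lebesgue_measure]_(t in `[u, v]) (t `^ (s - 1))%:E =
   ((v `^ s - u `^ s) / s)%:E)%E.
Proof.
move=> u0 uv s0.
have cont (p x : R) : 0 < x -> {for x, continuous (fun t : R => t `^ p)}.
  move=> x0; apply: differentiable_continuous; apply/derivable1_diffP.
  by have [] := is_derive1_powR p x0.
rewrite (@continuous_FTC2 _ _ (fun t => t `^ s / s)).
- by rewrite -EFinB mulrBl.
- by [].
- apply: continuous_in_subspaceT => x; rewrite inE/= in_itv/= => /andP[ux _].
  by apply: cont; exact: lt_le_trans ux.
- split.
  + move=> x; rewrite in_itv/= => /andP[ux _].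
    apply: derivableM => //.
    by have [] := is_derive1_powR s (lt_trans u0 ux).
  + apply: cvgM; last exact: cvg_cst.
    by apply: cvg_at_right_filter; exact: cont.
  + apply: cvgM; last exact: cvg_cst.
    by apply: cvg_at_left_filter; apply: cont; exact: lt_trans uv.
- move=> x; rewrite in_itv/= => /andP[ux _].
  have x0 := lt_trans u0 ux.
  rewrite derive1E.
  have D := is_derive1_powR s x0.
  have D' : is_derive x 1 (s^-1 *: (fun t : R => t `^ s)) (s^-1 *: (s * x `^ (s - 1))).
    exact: is_deriveZ.
  rewrite (_ : (fun t => t `^ s / s) = s^-1 *: (fun t : R => t `^ s)).
    by rewrite derive_val /GRing.scale/= mulrA mulVf// mul1r.
  by apply/funext => t; rewrite mulrC.
Qed.

End GammaLaw.

Section GammaProbability.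
Context {R : realType}.

Lemma measure_nondecreasing_le d (T : measurableType d)
    (mu : {measure set T -> \bar R}) (F : nat -> set T) (p : \bar R) :
  (forall k, measurable (F k)) -> nondecreasing_seq F ->
  (forall k, (mu (F k) <= p)%E) -> (mu (\bigcup_k F k) <= p)%E.
Proof.
move=> mF ndF Fp.
have h : (mu \o F) x @[x --> \oo] --> mu (\bigcup_n F n).
  by apply: nondecreasing_cvg_mu => //; exact: bigcup_measurable.
rewrite -(cvg_lim _ h)//; apply: lime_le; first by apply/cvg_ex; eexists; exact: h.
by apply: nearW.
Qed.

Context d (Omega : measurableType d) (P : probability Omega R).
Implicit Types (a : R) (X : Omega -> R).

Lemma measurable_gamma_pdf a : measurable_fun setT (gamma_pdf a).
Proof.
rewrite /gamma_pdf; apply: measurable_fun_if => //.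
- exact: measurable_fun_ltr.
- apply: measurable_funTS; apply: measurable_funM => //.
  apply: measurable_funM; first exact: measurable_powR.
  by apply: measurableT_comp => //; exact: measurable_oppr.
Qed.

Lemma gamma_pdf_ge0 a t : 0 <= gamma_pdf a t.
Proof.
rewrite /gamma_pdf; case: ifPn => // t0.
rewrite divr_ge0 ?mulr_ge0 ?powR_ge0 ?expR_ge0//.
by apply: Rintegral_ge0 => // x _; rewrite mulr_ge0 ?powR_ge0 ?expR_ge0.
Qed.

(** [Gamma a] is 0 when the defining integral diverges, and division by 0 would
    then give a null density; the existence of X excludes this. *)
Lemma Gamma_gt0 a X : gamma_distributed P a X -> 0 < Gamma a.
Proof.
move=> [mX lX]; rewrite lt_neqAle; apply/andP; split; last first.
  by apply: Rintegral_ge0 => // x _; rewrite mulr_ge0 ?powR_ge0 ?expR_ge0.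
apply/negP => /eqP G0.
have := lX setT measurableT; rewrite preimage_setT probability_setT.
rewrite integral0_eq => [/eqP|t _]; first by rewrite onee_eq0.
by rewrite /gamma_pdf -G0 invr0 mulr0 if_same.
Qed.

Lemma gamma_le0 a X : gamma_distributed P a X -> P (X @^-1` `]-oo, 0]) = 0.
Proof.
move=> [mX lX]; rewrite lX// integral0_eq// => t /=.
by rewrite in_itv/= /gamma_pdf ltNge => ->.
Qed.

(** Every estimate of the Gamma law used below compares its density with a
    power, which has an explicit primitive. *)
Lemma gamma_itv_le a X (c s u v : R) : gamma_distributed P a X ->
  0 < u -> u <= v -> s != 0 ->
  (forall t, 0 < t -> t `^ (a - 1) * expR (- t) <= c * t `^ (s - 1)) ->
  (P (X @^-1` `[u, v]) <= (c / Gamma a * ((v `^ s - u `^ s) / s))%:E)%E.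
Proof.
move=> gX u0 uv s0 H; have G0 := Gamma_gt0 gX; case: gX => mX lX.
rewrite lX//; move: uv; rewrite le_eqVlt => /orP[/eqP <-|uv].
  by rewrite set_itv1 integral_set1 subrr mul0r mulr0.
rewrite EFinM -(integral_powR u0 uv s0).
have c0 : 0 <= c.
  have := H 1 ltr01; rewrite powR1 mul1r mulr1; apply: le_trans.
  exact: expR_ge0.
rewrite -ge0_integralZl//.
- apply: ge0_le_integral => //.
  + by move=> t _; rewrite lee_fin gamma_pdf_ge0.
  + apply/measurable_EFinP; apply: measurable_funTS; exact: measurable_gamma_pdf.
  + apply: measurable_funTS; apply: emeasurable_funM => //.
    by apply/measurable_EFinP; exact: measurable_powR.
  + move=> t /=; rewrite in_itv/= => /andP[ut _].
    have t0 := lt_le_trans u0 ut.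
    rewrite -EFinM lee_fin /gamma_pdf t0 [leRHS]mulrAC ler_pM2r ?invr_gt0//.
    exact: H.
- by apply: measurable_funTS; apply/measurable_EFinP; exact: measurable_powR.
- by move=> t _; rewrite lee_fin powR_ge0.
- by rewrite lee_fin divr_ge0// ltW.
Qed.

(** t^(a-1) exp(-t) is bounded by a multiple of t^(-2). *)
Lemma gamma_tail_le a : 0 < a -> exists C : R, 
  forall X (T : R), gamma_distributed P a X -> 0 < T ->
    (P (X @^-1` `]T, +oo[) <= (C / T)%:E)%E.
Proof.
move=> a0.
have [C C0 HC] := @powR_mul_expRN_bounded R (a + 1) (addr_ge0 (ltW a0) ler01).
exists (C / Gamma a) => X T gX T0; have [mX lX] := gX; have G0 := Gamma_gt0 gX.
have mF k : measurable (X @^-1` `[T, T + k%:R]).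
  by rewrite -[_ @^-1` _]setTI; exact: mX.
apply: (@le_trans _ _ (P (\bigcup_k (X @^-1` `[T, T + k%:R])))).
  apply: le_measure; rewrite ?inE.
  - by rewrite -[_ @^-1` _]setTI; exact: mX.
  - exact: bigcup_measurable.
  - move=> w /=; rewrite in_itv/= andbT => Tw.
    exists (Num.trunc (X w - T)).+1 => //=; rewrite in_itv/= (ltW Tw)/= -lerBlDl.
    exact/ltW/truncnS_gt.
apply: measure_nondecreasing_le => // [|k].
  move=> k l kl; apply/subsetPset => w /=; rewrite !in_itv/= => /andP[-> h]/=.
  by rewrite (le_trans h)// lerD2l ler_nat.
have Tk : T <= T + k%:R by rewrite lerDl.
have n1 : (- 1 : R) != 0 by rewrite oppr_eq0 oner_eq0.
have H t : 0 < t -> t `^ (a - 1) * expR (- t) <= C * t `^ (- 1 - 1).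
  move=> t0; apply: (@le_trans _ _ (t `^ (a + 1) * expR (- t) * t `^ (- 1 - 1))).
    rewrite mulrAC -powRD; last by rewrite (gt_eqF t0) implybT.
    by rewrite (_ : a + 1 + (- 1 - 1) = a - 1)//; lra.
  by rewrite ler_wpM2r ?powR_ge0// HC.
apply: (le_trans (gamma_itv_le gX T0 Tk n1 H)).
rewrite lee_fin ler_wpM2l ?divr_ge0 ?(ltW C0) ?(ltW G0)//.
rewrite invrN invr1 mulrN1 opprB !powR_inv1 ?(ltW T0) ?(le_trans (ltW T0) Tk)//.
by rewrite lerBlDr lerDl invr_ge0 (le_trans (ltW T0)).
Qed.

(** The density is bounded by a multiple of t^(al-1) with al = min(a, 1), and
    v^al - u^al <= (v - u)^al since al <= 1.  The intervals cut at 1/(k+1)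
    avoid the singularity at 0. *)
Lemma gamma_small_interval_le a : 0 < a -> exists2 al : R, 0 < al &
  exists C : R, forall X (u h : R), gamma_distributed P a X -> 0 < h ->
    (P (X @^-1` `[u, (u + h)%R]) <= (C * h `^ al)%:E)%E.
Proof.
move=> a0; pose al := Num.min a 1.
have al0 : 0 < al by rewrite lt_min a0 ltr01.
have al1 : al <= 1 by rewrite ge_min lexx orbT.
have ala : 0 <= a - al by rewrite subr_ge0 ge_min lexx.
have [C C0 HC] := powR_mul_expRN_bounded ala.
exists al => //; exists (C / Gamma a / al) => X u h gX h0.
have [mX lX] := gX; have G0 := Gamma_gt0 gX.
pose F k := X @^-1` `[Num.max u k.+1%:R^-1, u + h].
have mF k : measurable (F k) by rewrite /F -[_ @^-1` _]setTI; exact: mX.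
have mN : measurable (X @^-1` `]-oo, 0]) by rewrite -[_ @^-1` _]setTI; exact: mX.
apply: (@le_trans _ _ (P (X @^-1` `]-oo, 0] `|` \bigcup_k F k))).
  apply: le_measure; rewrite ?inE.
  - by rewrite -[_ @^-1` _]setTI; exact: mX.
  - by apply: measurableU => //; exact: bigcup_measurable.
  - move=> w /=; rewrite !in_itv/= => /andP[uX Xh].
    have [?|X0] := leP (X w) 0; [by left|right].
    exists (Num.trunc (X w)^-1) => //; rewrite /F/= in_itv/= Xh andbT ge_max uX/=.
    rewrite invf_ple ?posrE//; exact/ltW/truncnS_gt.
have mU : measurable (\bigcup_k F k) by exact: bigcup_measurable.
rewrite setUC (measureU0 mU mN (gamma_le0 gX)).
apply: measure_nondecreasing_le => // [k l kl|k].
  apply/subsetPset => w; rewrite /F /= !in_itv/= => /andP[+ ->]; rewrite andbT.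
  apply: le_trans; rewrite ge_max !le_max lexx/=.
  by rewrite lef_pV2 ?posrE// ler_nat ltnS kl orbT.
have m0 : 0 < Num.max u k.+1%:R^-1 by rewrite lt_max invr_gt0 ltr0n orbT.
have [muh|uhm] := leP (Num.max u k.+1%:R^-1) (u + h); last first.
  rewrite /F set_itv_ge ?preimage_set0 ?measure0 -?ltNge ?bnd_simp//.
  by rewrite lee_fin mulr_ge0 ?powR_ge0// !divr_ge0 ?(ltW C0) ?(ltW G0) ?(ltW al0).
have H t : 0 < t -> t `^ (a - 1) * expR (- t) <= C * t `^ (al - 1).
  move=> t0; apply: (@le_trans _ _ (t `^ (a - al) * expR (- t) * t `^ (al - 1))).
    rewrite mulrAC -powRD; last by rewrite (gt_eqF t0) implybT.
    by rewrite (_ : a - al + (al - 1) = a - 1)//; lra.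
  by rewrite ler_wpM2r ?powR_ge0// HC.
apply: (le_trans (gamma_itv_le gX m0 muh (lt0r_neq0 al0) H)).
rewrite lee_fin -[leRHS]mulrA -2!mulrA.
apply: ler_wpM2l; first by rewrite ltW.
apply: ler_wpM2l; first by rewrite invr_ge0 ltW.
rewrite mulrC; apply: ler_wpM2l; first by rewrite invr_ge0 ltW.
set m := Num.max _ _ in m0 muh *.
have um : u <= m by rewrite le_max lexx.
move: muh; rewrite le_eqVlt => /orP[/eqP <-|muh].
  by rewrite subrr powR_ge0.
have d0 : 0 < u + h - m by rewrite subr_gt0.
have := powR_subadditive al0 al1 (ltW m0) d0.
rewrite [m + _]addrC subrK => /le_trans; apply.
by rewrite ge0_ler_powR ?nnegrE ?(ltW al0) ?(ltW d0) ?(ltW h0)//; lra.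
Qed.

End GammaProbability.

(** * One weight is independent of everything before it and beside it *)

Section Others.
Context d (Omega : measurableType d) (R : realType) (P : probability Omega R).
Context d1 (T1 : measurableType d1) (I : choiceType) (D : set I) (X : I -> Omega -> T1).
Context d2 (T2 : measurableType d2) (Y : Omega -> T2).
Implicit Types (i : I) (S : set Omega).

(** A pi-system that generates the sigma-algebra of Y and of all X i with
    i <> i0 in D. *)
Definition other_cylinders i0 : set (set Omega) :=
  [set S | exists (E : set T2) (J : {fset I}) (A : I -> set T1),
    [/\ measurable E, [set` J] `<=` D `\ i0, forall i, measurable (A i) &
        S = Y @^-1` E `&` \bigcap_(i in [set` J]) (X i @^-1` A i)]].

Definition others i0 : set (set Omega) := <<s other_cylinders i0 >>.

Lemma setI_closed_other_cylinders i0 : setI_closed (other_cylinders i0).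
Proof.
move=> _ _ [E [J [A [mE JD mA ->]]]] [E' [J' [A' [mE' JD' mA' ->]]]].
pose B i := (if i \in J then A i else setT) `&` (if i \in J' then A' i else setT).
exists (E `&` E'), (J `|` J')%fset, B; split.
- exact: measurableI.
- by move=> i /=; rewrite inE => /orP[/JD|/JD'].
- by move=> i; apply: measurableI; case: ifP.
- rewrite preimage_setI; apply/seteqP; split => w /=.
  + move=> [[Ew Aw] [E'w A'w]]; split => // i /= _; rewrite /B; split.
      by case: ifPn => // /Aw.
    by case: ifPn => // /A'w.
  + move=> [[Ew E'w] Bw]; split; split => // i /= iJ.
      by have [] := Bw i; rewrite /= ?inE ?iJ// /B iJ.
    by have [] := Bw i; rewrite /= ?inE ?iJ ?orbT// /B iJ.
Qed.

Hypothesis mX : forall i, D i -> measurable_fun setT (X i).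
Hypothesis mY : measurable_fun setT Y.

Lemma measurable_other_cylinders i0 S : other_cylinders i0 S -> measurable S.
Proof.
move=> [E [J [A [mE JD mA ->]]]]; apply: measurableI.
  by rewrite -[_ @^-1` _]setTI; exact: mY.
apply: fin_bigcap_measurable; first exact: finite_fset.
move=> i /JD[Di _]; rewrite -[_ @^-1` _]setTI; exact: mX.
Qed.

Lemma measurable_others i0 S : others i0 S -> measurable S.
Proof.
move: S; apply: smallest_sub; first exact: sigma_algebra_measurable.
exact: measurable_other_cylinders.
Qed.

Lemma others_Y i0 : measurable_fun (setT : set (g_sigma_algebraType (other_cylinders i0))) Y.
Proof.
move=> _ E mE; rewrite setTI; apply: sub_sigma_algebra.
exists E, fset0, (fun=> setT); split => //.
by rewrite set_fset0 bigcap_set0 setIT.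
Qed.

Lemma others_X i0 i : D i -> i <> i0 ->
  measurable_fun (setT : set (g_sigma_algebraType (other_cylinders i0))) (X i).
Proof.
move=> Di ii0 _ A mA; rewrite setTI; apply: sub_sigma_algebra.
exists setT, [fset i]%fset, (fun=> A); split => //.
  by move=> j /=; rewrite inE => /eqP ->; split.
by rewrite preimage_setT setTI set_fset1 bigcap_set1.
Qed.

Hypothesis indX : mutually_independent P D X.
Hypothesis indXY : independent_sigma P (sigma_generated D X) (g_sigma_algebra_preimage Y).

Lemma sigma_generated_bigcap (J : {fset I}) (A : I -> set T1) :
  [set` J] `<=` D -> (forall i, measurable (A i)) ->
  sigma_generated D X (\bigcap_(i in [set` J]) (X i @^-1` A i)).
Proof.
move=> JD mA.
pose G := \bigcup_(i in D) g_sigma_algebra_preimage (X i).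
have := @fin_bigcap_measurable _ (g_sigma_algebraType G) I [set` J]
  (fun i => X i @^-1` A i) (finite_fset J).
apply => i iJ; apply: sub_sigma_algebra; exists i; first exact: JD.
by exists (A i) => //; rewrite setTI.
Qed.

(** On cylinders this is the product formula for the X i, combined with the
    independence of Y; Dynkin's lemma extends it. *)
Lemma others_independent i0 (A0 : set T1) S : D i0 -> measurable A0 ->
  others i0 S -> P (X i0 @^-1` A0 `&` S) = (P (X i0 @^-1` A0) * P S)%E.
Proof.
move=> Di0 mA0; set H := X i0 @^-1` A0.
have mH : measurable H by rewrite -[H]setTI; exact: mX.
have mO S' : others i0 S' -> measurable S' by exact: measurable_others.
move: S.
apply: (@dynkin_induction _ (g_sigma_algebraType (other_cylinders i0))
  (other_cylinders i0) (fun S => P (H `&` S) = (P H * P S)%E)) => //.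
- exact: setI_closed_other_cylinders.
- by rewrite setIT probability_setT mule1.
- move=> _ [E [J [A [mE JD mA ->]]]].
  have JD' : [set` J] `<=` D by move=> i /JD[].
  have i0J : i0 \notin J by apply/negP => /JD[_]; exact.
  have pY : g_sigma_algebra_preimage Y (Y @^-1` E) by exists E => //; rewrite setTI.
  pose A' i := if i == i0 then A0 else A i.
  have mA' i : measurable (A' i) by rewrite /A'; case: ifP.
  have JD0 : [set` (i0 |` J)%fset] `<=` D.
    by move=> i /=; rewrite !inE => /orP[/eqP ->//|/JD'].
  set K := \bigcap_(i in _) _.
  have HK : H `&` K = \bigcap_(i in [set` (i0 |` J)%fset]) (X i @^-1` A' i).
    apply/seteqP; split => w.
      move=> [Hw Kw] i /=; rewrite !inE => /orP[/eqP ->|iJ].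
        by rewrite /A' eqxx.
      rewrite /A'; case: eqP => [ii0|_]; last exact: Kw.
      by rewrite -ii0 iJ in i0J.
    move=> h; split; first by have := h i0; rewrite /= fset1U1 /A' eqxx; exact.
    move=> i /= iJ; have := h i; rewrite /= fset1Ur// => /(_ isT).
    rewrite /A'; case: eqP => // ii0; by rewrite -ii0 iJ in i0J.
  rewrite setICA [X in P X]setIC HK indXY//; last exact: sigma_generated_bigcap.
  rewrite indX// big_fsetU1//= {1}/A' eqxx -/H.
  rewrite (eq_big_seq (fun i => P (X i @^-1` A i))); last first.
    move=> i iJ; rewrite /A'; case: eqP => // ii0; by rewrite -ii0 iJ in i0J.
  rewrite -(indX JD' mA) -/K setIC indXY//; last exact: sigma_generated_bigcap.
  by rewrite muleA.
- move=> S mS PS; have mS' := mO _ mS.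
  have -> : H `&` ~` S = H `\` (H `&` S).
    by rewrite setDIr setDv set0U.
  rewrite measureD//; last 2 first.
    exact: measurableI.
    by rewrite (le_lt_trans (probability_le1 _ _))// ltry.
  rewrite setIA setIid.
  transitivity (P H - P H * P S)%E; first by congr (_ - _)%E; exact: PS.
  rewrite probability_setC// muleBr ?mule1//.
  by rewrite fin_num_measure.
- move=> F0 mF tF PF; pose F : nat -> set Omega := F0.
  have mF' n : measurable (F n) by exact: (mO _ (mF n)).
  rewrite -[F0]/F.
  rewrite setI_bigcupr !measure_bigcup//=.
  + have <- : (fine (P H))%:E = P H by rewrite fineK// fin_num_measure.
    rewrite -nneseriesZl//.
    rewrite fineK ?fin_num_measure//.
    by apply: eq_eseriesr => n _; exact: PF.
  + by move=> n _; exact: measurableI.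
  + exact: trivIset_setIl.
Qed.

(** V is cut into cells of length dl: on the cell of index k the event forces
    f (X i0) into an interval of length 3 dl, and that interval event is
    independent of the cell.  Summing over cells replaces conditioning on V. *)
Lemma small_ball_independent i0 (f : T1 -> R) (V : Omega -> R) (dl p : R) :
  D i0 -> 0 < dl -> measurable_fun setT f ->
  measurable_fun (setT : set (g_sigma_algebraType (other_cylinders i0))) V ->
  (forall u : R, P [set w | (f (X i0 w) \in `[u, u + 3 * dl])%R] <= p%:E)%E ->
  (P [set w | (`|f (X i0 w) + V w| < dl)%R] <= p%:E)%E.
Proof.
move=> Di0 dl0 mf mV Hp.
have p0 : 0 <= p by rewrite -lee_fin; exact: le_trans (Hp 0).
(* cells have indices in int, enumerated by natural numbers *)
pose cell n := [set w | choice.pickle (Num.floor (V w / dl)) = n].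
pose K n : set R := [set v | choice.pickle (Num.floor (v / dl)) = n].
have mK n : measurable (K n).
  have [[k kn]|nk] := pselect (exists k : int, choice.pickle k = n).
    have -> : K n = `[k%:~R * dl, (k + 1)%:~R * dl[%classic.
      apply/seteqP; split => v /=; rewrite /K/= in_itv/= -ler_pdivlMr// -ltr_pdivrMr//.
        rewrite -kn => /(pcan_inj choice.pickleK) <-.
        by rewrite ge_floor floorD1_gt.
      by move=> h; rewrite -kn (floor_def h).
    exact: measurable_itv.
  have -> : K n = set0; last by [].
  by rewrite -subset0 => v /= h; apply: nk; eexists; exact: h.
have oC n : others i0 (cell n).
  have := mV measurableT (K n) (mK n); rewrite setTI; exact.
have mC n : measurable (cell n) by exact: measurable_others (oC n).
have cU : \bigcup_n cell n = setT by apply/seteqP; split => // w _; eexists.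
have tC : trivIset setT cell by move=> n m _ _ [w [/= <- <-]].
set S := [set w | _].
have mV' : measurable_fun setT V.
  move=> _ B mB; have := mV measurableT B mB; exact: measurable_others.
have mfX : measurable_fun setT (fun w => f (X i0 w)) by apply: measurableT_comp => //; exact: mX.
have mS : measurable S.
  have -> : S = (fun w => f (X i0 w) + V w) @^-1` `](-dl), dl[%classic.
    by apply/seteqP; split => w /=; rewrite /S/= in_itv/= ltr_norml.
  by rewrite -[_ @^-1` _]setTI; apply: measurable_funD.
have -> : S = \bigcup_n (S `&` cell n) by rewrite -setI_bigcupr cU setIT.
rewrite measure_bigcup//; last 2 first.
  by move=> n _; exact: measurableI.
  exact: trivIset_setIl.
apply: (@le_trans _ _ (\sum_(0 <= n <oo | n \in [set: nat]) (p%:E * P (cell n)))%E); last first.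
  rewrite nneseriesZl// -measure_bigcup// -[leRHS]mule1 lee_wpmul2l//.
  by apply: probability_le1; exact: bigcup_measurable.
apply: lee_nneseries => [n _ _|n _]; first exact: measure_ge0.
have [[k kn]|nk] := pselect (exists k : int, choice.pickle k = n); last first.
  have -> : S `&` cell n = set0.
    by rewrite -subset0 => w /= [_ h]; apply: nk; eexists; exact: h.
  by rewrite measure0 mule_ge0.
pose u := - (k + 1)%:~R * dl - dl.
have mU : measurable (f @^-1` [set x | x \in `[u, u + 3 * dl]]).
  rewrite -[_ @^-1` _]setTI; apply: mf => //.
apply: (@le_trans _ _ (P (X i0 @^-1` (f @^-1` [set x | x \in `[u, u + 3 * dl]]) `&` cell n))).
  apply: le_measure; rewrite ?inE; [exact: measurableI| |].
    apply: measurableI => //; rewrite -[_ @^-1` _]setTI; exact: mX.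
  move=> w [Sw cw]; split => //; move: cw; rewrite /cell/= -kn => /(pcan_inj choice.pickleK) fk.
  have h1 := ge_floor (V w / dl); have h2 := floorD1_gt (V w / dl).
  rewrite fk in h1 h2; rewrite ler_pdivlMr// in h1; rewrite ltr_pdivrMr// in h2.
  move: Sw; rewrite /S/= in_itv/= ltr_norml => /andP[l1 l2].
  by rewrite /u; move: h1 h2; rewrite intrD => h1 h2; apply/andP; split; lra.
rewrite others_independent//; apply: lee_wpmul2r => //; exact: Hp.
Qed.

End Others.

(** * Topology and measurability on the complex plane *)

Section BorelC.
Context {R : realType}.
Implicit Types a b : R[i].
Local Notation nc := (@Normc.normc R).

Lemma ball_modulus a b (e : R) : ball (a : R[i]^o) e%:C%C b <-> nc (a - b) < e.
Proof. by rewrite /ball /= -ltcR. Qed.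

Lemma nbhs_modulus (a : R[i]^o) (e : R) : 0 < e -> nbhs a [set b | nc (a - b) < e].
Proof.
move=> e0; apply/nbhs_ballP; exists e%:C%C; first by rewrite /= ltcR.
by move=> b /ball_modulus.
Qed.

(** Radii of balls in [R[i]^o] are elements of [R[i]]; positive ones are real. *)
Lemma nbhs_modulusP (a : R[i]^o) (A : set R[i]^o) : nbhs a A ->
  exists2 e : R, 0 < e & forall b, nc (a - b) < e -> A b.
Proof.
move=> /nbhs_ballP[e /= e0 eA].
have [r er] : exists r : R, e = r%:C%C.
  by apply/complex_realP; rewrite ger0_real// ltW.
exists r; first by rewrite -ltcR -er.
by move=> b ab; apply: eA; rewrite er; apply/ball_modulus.
Qed.

Lemma lipschitz_continuous (f : R[i]^o -> R) (K : R) :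
  (forall a b, `|f a - f b| <= K * nc (a - b)) -> continuous f.
Proof.
move=> fK a. apply/(@cvgrPdist_lt _ _ _ _ (nbhs_filter (a : R[i]^o))) => e e0.
have K0 : 0 < `|K| + 1 by rewrite ltr_wpDl.
apply/nbhs_ballP; exists (e / (`|K| + 1))%:C%C.
  by rewrite /= ltcR divr_gt0.
move=> b /ball_modulus /=; rewrite ltr_pdivlMr// mulrC; apply: le_lt_trans.
apply: (le_trans (fK _ _)); rewrite ler_wpM2r ?modulus_ge0//.
by rewrite (le_trans (ler_norm _))// lerDl.
Qed.

Lemma continuous_borelC_measurable (f : R[i]^o -> R) : continuous f ->
  measurable_fun setT (f : borelC R -> R).
Proof.
move=> cf; apply: (measurability _ (RGenOInfty.measurableE R)).
move=> _ [_ [x ->] <-]; rewrite setTI; apply: sub_sigma_algebra.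
by move/continuousP : cf; apply; exact: interval_open.
Qed.

Lemma measurable_Re : measurable_fun setT (@complex.Re R : borelC R -> R).
Proof.
apply: continuous_borelC_measurable; apply: (@lipschitz_continuous _ 1) => a b.
by rewrite mul1r -raddfB; exact: le_Re_modulus.
Qed.

Lemma measurable_Im : measurable_fun setT (@complex.Im R : borelC R -> R).
Proof.
apply: continuous_borelC_measurable; apply: (@lipschitz_continuous _ 1) => a b.
by rewrite mul1r -raddfB; exact: le_Im_modulus.
Qed.

Lemma measurable_modulus : measurable_fun setT (nc : borelC R -> R).
Proof.
apply: continuous_borelC_measurable; apply: (@lipschitz_continuous _ 1) => a b.
rewrite mul1r ler_norml; have := modulus_dist_dist a b.
by have := modulus_dist_dist b a; rewrite modulus_distC => h1 h2; apply/andP; split; lra.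
Qed.

(** The inverse is written as a power because power functions are known to be
    measurable on the whole line. *)
Lemma Re_divE a b : complex.Re (a / b) =
  (complex.Re a * complex.Re b + complex.Im a * complex.Im b) *
  (complex.Re b ^+ 2 + complex.Im b ^+ 2) `^ (- 1).
Proof.
rewrite powR_inv1 ?addr_ge0 ?sqr_ge0//.
by case: a b => [p q] [s t] /=; ring.
Qed.

Lemma measurable_Re_div d (T : measurableType d) (x : R[i]) (f g : T -> borelC R) :
  measurable_fun setT f -> measurable_fun setT g ->
  measurable_fun setT (fun w => complex.Re ((x - f w : R[i]) / (x - g w))).
Proof.
move=> mf mg; under eq_fun do rewrite Re_divE !raddfB/=.
have mRe (h : T -> borelC R) : measurable_fun setT h ->
    measurable_fun setT (fun w : T => complex.Re x - complex.Re (h w : R[i])).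
  by move=> mh; apply: measurable_funB => //; exact: measurableT_comp measurable_Re mh.
have mIm (h : T -> borelC R) : measurable_fun setT h ->
    measurable_fun setT (fun w : T => complex.Im x - complex.Im (h w : R[i])).
  by move=> mh; apply: measurable_funB => //; exact: measurableT_comp measurable_Im mh.
apply: measurable_funM.
  by apply: measurable_funD; apply: measurable_funM; auto.
apply: (@measurableT_comp _ _ _ _ _ _ (fun y : R => y `^ (- 1)));
  first exact: measurable_powR.
by apply: measurable_funD; apply: measurable_funX; auto.
Qed.

End BorelC.

(** * Properties that hold outside an event of small probability *)

Section HoldsOutside.
Context d (Omega : measurableType d) (R : realType) (P : probability Omega R).
Implicit Types (p q : R) (Q : Omega -> Prop).

(** A bound for the outer probability of the failure of Q, which needs no
    measurability of Q. *)
Definition holds_outside p Q : Prop :=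
  exists E, [/\ measurable E, (P E <= p%:E)%E & forall w, ~ E w -> Q w].

Lemma holds_outside_sub p q Q Q' : p <= q -> (forall w, Q w -> Q' w) ->
  holds_outside p Q -> holds_outside q Q'.
Proof.
move=> pq QQ' [E [mE PE EQ]]; exists E; split => //.
- by rewrite (le_trans PE)// lee_fin.
- by move=> w /EQ/QQ'.
Qed.

Lemma holds_outside_compl p Q (E : set Omega) : measurable E ->
  (P E <= p%:E)%E -> (forall w, ~ E w -> Q w) -> holds_outside p Q.
Proof. by move=> mE PE EQ; exists E. Qed.

Lemma ae_holds_outside Q : {ae P, forall w, Q w} -> holds_outside 0 Q.
Proof.
move=> [E [mE PE EQ]]; exists E; split => //; first by rewrite PE.
by move=> w Ew; apply: contrapT => nQ; apply: Ew; exact: EQ.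
Qed.

Lemma holds_outside_ge0 p Q : holds_outside p Q -> 0 <= p.
Proof. by move=> [E [mE PE _]]; rewrite -lee_fin (le_trans _ PE). Qed.

Lemma holds_outside_and p q Q Q' : holds_outside p Q -> holds_outside q Q' ->
  holds_outside (p + q) (fun w => Q w /\ Q' w).
Proof.
move=> [E [mE PE EQ]] [F [mF PF FQ]]; exists (E `|` F); split.
- exact: measurableU.
- by rewrite (le_trans (measureU2 _ mE mF))// EFinD leeD.
- by move=> w nEF; split; [apply: EQ|apply: FQ] => h; apply: nEF; [left|right].
Qed.

Lemma holds_outside_forall_in (I : eqType) (s : seq I) p (Q : I -> Omega -> Prop) :
  (forall i, i \in s -> holds_outside p (Q i)) ->
  holds_outside ((size s)%:R * p) (fun w => forall i, i \in s -> Q i w).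
Proof.
elim: s => [|a s IH] h.
  by exists set0; split => //; rewrite measure0 mul0r.
have h1 := h a (mem_head _ _).
have h2 : holds_outside ((size s)%:R * p) (fun w => forall i, i \in s -> Q i w).
  by apply: IH => i si; apply: h; rewrite inE si orbT.
apply: holds_outside_sub (holds_outside_and h1 h2).
  by rewrite /= -natr1; lra.
by move=> w [Qa Qs] i; rewrite inE => /orP[/eqP ->//|]; exact: Qs.
Qed.

Lemma holds_outside_forall_lt n p (Q : nat -> Omega -> Prop) :
  (forall i, (i < n)%N -> holds_outside p (Q i)) ->
  holds_outside (n%:R * p) (fun w => forall i, (i < n)%N -> Q i w).
Proof.
move=> h; have := @holds_outside_forall_in _ (iota 0 n) p Q.
rewrite size_iota => H; apply: (holds_outside_sub (lexx _)); last first.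
  by apply: H => i; rewrite mem_iota => /h.
by move=> w H1 i ilt; apply: H1; rewrite mem_iota.
Qed.

Lemma sum_inv_square_lty (C : R) : 0 <= C ->
  (\sum_(n <oo) (C / n.+1%:R ^+ 2)%:E < +oo)%E.
Proof.
move=> C0; apply: (@le_lt_trans _ _ (2 * C)%:E); last by rewrite ltry.
apply: lime_le; first by apply: is_cvg_nneseries => n _; rewrite lee_fin divr_ge0.
apply: nearW => n; rewrite sumEFin lee_fin.
suff : \sum_(0 <= i < n) C / i.+1%:R ^+ 2 <= 2 * C - 2 * C / n.+1%:R.
  by move=> /le_trans; apply; rewrite gerBl divr_ge0// mulr_ge0.
elim: n => [|n IH]; first by rewrite big_nil divr1; lra.
rewrite big_nat_recr//=; apply: (le_trans (lerD IH (lexx _))).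
have n0 : 1 <= n.+1%:R :> R by rewrite ler1n.
rewrite -[n.+2%:R]natr1; set y : R := n.+1%:R in n0 *.
(* y + 1 <= 2 y, so 1/y^2 <= 2/(y (y + 1)), which telescopes *)
have -> : 2 * C - 2 * C / (y + 1) =
    2 * C - 2 * C / y + C * (2 / (y * (y + 1))).
  by field; apply/andP; split; rewrite gt_eqF//; lra.
have y0 : 0 < y by lra.
have y1 : 0 < y + 1 by lra.
rewrite lerD2l; apply: ler_wpM2l => //.
rewrite ler_pdivlMr ?mulr_gt0// mulrC ler_pdivrMr ?exprn_gt0//; nra.
Qed.

(** Borel-Cantelli. *)
Lemma holds_outside_eventually (C : R) (Q : nat -> Omega -> Prop) :
  (forall n, (2 <= n)%N -> holds_outside (C / n%:R ^+ 2) (Q n)) ->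
  {ae P, forall w, exists N, forall n, (N <= n)%N -> Q n w}.
Proof.
move=> H.
have C0 : 0 <= C.
  by have := holds_outside_ge0 (H 2%N isT); rewrite pmulr_lge0// invr_gt0 exprn_gt0.
have K : forall n, exists E : set Omega, [/\ measurable E,
    (P E <= (4 * C / n.+1%:R ^+ 2)%:E)%E & (2 <= n)%N -> forall w, ~ E w -> Q n w].
  move=> n; have [n2|n2] := leqP 2 n; last first.
    exists set0; split => //; rewrite measure0 lee_fin divr_ge0// mulr_ge0//.
  have [E [mE PE EQ]] := H n n2; exists E; split => //.
  apply: (le_trans PE); rewrite lee_fin.
  have n0 : 1 <= n%:R :> R by rewrite ler1n ltnW.
  rewrite ler_pdivrMr ?exprn_gt0 ?ltr0n 1?ltnW// mulrAC ler_pdivlMr ?exprn_gt0//.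
  rewrite -natr1; set y : R := n%:R in n0 *.
  have h : (y + 1) ^+ 2 <= 4 * y ^+ 2 by nra.
  by have := ler_wpM2l C0 h; lra.
have [E HE] := choice K.
have mE n : measurable (E n) by have [] := HE n.
have : P (lim_sup_set E) = 0%E.
  apply: lim_sup_set_cvg0 => //.
  apply: le_lt_trans (@sum_inv_square_lty (4 * C) _); last by rewrite mulr_ge0.
  by apply: lee_nneseries => n // _; have [] := HE n.
move=> PE0; exists (lim_sup_set E); split => //.
  by apply: bigcap_measurable => // k _; apply: bigcup_measurable.
move=> w nQ n _; apply: contrapT => nE; apply: nQ; exists (maxn 2 n) => k.
rewrite geq_max => /andP[k2 nk]; have [_ _ kQ] := HE k.
by apply: kQ => // Ekw; apply: nE; exists k.
Qed.

End HoldsOutside.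

(** * The exceptional events of one step *)

Section MinModulus.
Context {R : realType}.
Local Notation nc := (@Normc.normc R).

Lemma min_modulus_ge (z : seq R[i]) (b : R) : (0 < size z)%N ->
  (forall x, x \in z -> b <= nc x) -> b <= min_modulus z.
Proof.
rewrite /min_modulus => z0 h; rewrite big_seq.
apply: (big_ind (fun y => b <= y)).
- by case: z z0 h => [//|a z _ h]; exact: (h a (mem_head _ _)).
- by move=> x y bx by_; rewrite le_min bx by_.
- by move=> i iz; exact: h.
Qed.

Lemma min_modulus_ge0 (z : seq R[i]) : 0 <= min_modulus z.
Proof.
rewrite /min_modulus; elim/big_ind : _ => //; try by move=> *; exact: modulus_ge0.
by move=> x y x0 y0; rewrite le_min x0 y0.
Qed.

Lemma measurable_min_modulus d (T : measurableType d) N (z : T -> N.-tuple (borelC R)) :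
  measurable_fun setT z ->
  measurable_fun setT (fun w => min_modulus (z w : seq R[i])).
Proof.
case: N z => [|N] z mz.
  rewrite (_ : (fun w => _) = (fun=> nc 0)) //; apply/funext => w.
  by rewrite tuple0 /min_modulus big_nil.
have mzi i : measurable_fun setT (fun w => nc (tnth (z w) i)).
  apply: measurableT_comp measurable_modulus _.
  exact: measurableT_comp (measurable_tnth i) mz.
rewrite (_ : (fun w => _) = fun w => \big[Num.min/nc (tnth (z w) ord0)]_(i <- index_enum 'I_N.+1) nc (tnth (z w) i)).
  elim: (index_enum _) => [|i s IH].
    under eq_fun do rewrite big_nil.
    exact: mzi.
  under eq_fun do rewrite big_cons.
  exact: measurable_minr.
apply/funext => w; rewrite /min_modulus big_tuple; congr (\big[_/nc _]_(_ <- _) _).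
by rewrite (tnth_nth (0 : R[i])) nth0.
Qed.

End MinModulus.

Section LevelEvents.
Context (R : realType) (d : measure_display) (Omega : measurableType d).
Context (P : probability Omega R) (beta : R) (m : nat -> nat).
Context (gamma : forall n j, Omega -> (n.+1 - j).-tuple R).
Context (Z : forall n j, Omega -> (n - j).-tuple (borelC R)).
Hypothesis Z_gamma : iterated_randomized_derivatives P beta m gamma Z.
Local Notation nc := (@Normc.normc R).
Local Notation X n := (gamma_entry gamma n).
Local Notation D n := (gamma_index m n).

Let mX n jk : (2 <= n)%N -> D n jk -> measurable_fun setT (X n jk).
Proof. by move=> n2 Djk; have [] := gamma_law Z_gamma n2 Djk. Qed.

Let mZ0 n : (2 <= n)%N -> measurable_fun setT (Z n 0).
Proof. by move=> n2; exact: (Z_measurable Z_gamma). Qed.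

(** The labelling makes each configuration a measurable function of the previous
    one and of the weights, so by induction of the initial points and of the
    weights of the earlier steps.  It holds almost surely only, whence the
    version Zt. *)
Lemma zeros_measurable_others n j i0 : (2 <= n)%N -> (j <= m n)%N -> (j < i0.1)%N ->
  exists Zt : Omega -> (n - j).-tuple (borelC R),
    measurable_fun (setT : set (g_sigma_algebraType
      (other_cylinders (D n) (X n) (Z n 0) i0))) Zt /\
    {ae P, forall w, Z n j w = Zt w}.
Proof.
move=> n2; elim: j => [|j IH] jm ji0.
  exists (Z n 0); split; first exact: others_Y.
  exact: aeW.
have [Zt [mZt ZZt]] := IH (ltnW jm) (ltnW ji0).
have [lab [mlab Zlab]] := Z_labelling Z_gamma n2 jm.
exists (fun w => lab (Zt w, gamma n j.+1 w)); split; last first.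
  by apply: filterS2 ZZt Zlab => w <- ->.
apply: (measurableT_comp mlab); apply: measurable_fun_pair => //.
apply/measurable_fun_tnthP => k.
have -> : (@tnth _ R)^~ k \o gamma n j.+1 = X n (j.+1, val k).
  by apply/funext => w /=; rewrite (tnth_nth 0).
apply: others_X.
- by split => //=; exact: ltn_ord.
- by move=> E; rewrite -E /= ltnn in ji0.
Qed.

(** With u = x - z_k, the real part of u * pole_sum is g_k plus this quantity,
    in which g_k does not occur: see offset_pole_sum. *)
Definition offset (x : R[i]) (g : seq R) (z : seq R[i]) (k : nat) : R :=
  \sum_(0 <= l < size z | l != k) g`_l * complex.Re ((x - z`_k) / (x - z`_l)).

Lemma offset_pole_sum x g z k : (k < size z)%N -> x \notin z ->
  g`_k + offset x g z k = complex.Re ((x - z`_k) * pole_sum g z x).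
Proof.
move=> kz xz; rewrite /pole_sum mulr_sumr raddf_sum /offset big_mkord.
rewrite [in RHS](bigD1 (Ordinal kz))//=; congr (_ + _).
  rewrite mulrCA mulfV ?mulr1//= subr_eq0.
  by apply: contraNneq xz => ->; exact: mem_nth.
apply: eq_big => [l|l _]; first by rewrite -val_eqE.
rewrite mulrCA; case: (_ / _) => u v /=; ring.
Qed.

Lemma measurable_offset d' (T : measurableType d') N x k
    (g : T -> N.-tuple R) (z : T -> N.-tuple (borelC R)) :
  (k < N)%N ->
  (forall l : 'I_N, val l != k -> measurable_fun setT (fun w => tnth (g w) l)) ->
  measurable_fun setT z ->
  measurable_fun setT (fun w => offset x (g w) (z w : seq R[i]) k).
Proof.
move=> kN mg mz.
pose F (l : 'I_N) w := tnth (g w) l *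
  complex.Re ((x - tnth (z w) (Ordinal kN) : R[i]) / (x - tnth (z w) l)).
have -> : (fun w => offset x (g w) (z w : seq R[i]) k) =
    fun w => \sum_(l < N | val l != k) F l w.
  apply/funext => w; rewrite /offset size_tuple big_mkord.
  by apply: eq_bigr => l _; rewrite /F !(tnth_nth 0)/=.
under eq_fun do rewrite big_mkcond.
apply: measurable_sum => l; move: (mg l) => /=.
case: (nat_of_ord l != k) => ml; last exact: measurable_cst.
apply: measurable_funM; first exact: ml.
apply: measurable_Re_div; exact: measurableT_comp (measurable_tnth _) mz.
Qed.

(** [offset] is almost surely a function of the weights other than the k-th one
    and of earlier data, hence independent of that weight. *)
Lemma weight_small_ball n j k x (al C dl : R) : (2 <= n)%N -> (j < m n)%N ->
  (k < n - j)%N -> 0 < dl ->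
  (forall X u h, gamma_distributed P (beta / 2) X -> 0 < h ->
    (P (X @^-1` `[u, (u + h)%R]) <= (C * h `^ al)%:E)%E) ->
  holds_outside P (C * (3 * dl) `^ al)
    (fun w => dl <= `|(gamma n j.+1 w)`_k + offset x (gamma n j.+1 w) (Z n j w) k|).
Proof.
move=> n2 jm kN dl0 HC.
have Di0 : D n (j.+1, k) by split => //=.
have [Zt [mZt ZZt]] := @zeros_measurable_others n j (j.+1, k) n2 (ltnW jm) (ltnSn j).
pose V w := offset x (gamma n j.+1 w) (Zt w) k.
have mV : measurable_fun (setT : set (g_sigma_algebraType
      (other_cylinders (D n) (X n) (Z n 0) (j.+1, k)))) V.
  apply: measurable_offset => // l lk.
  have -> : (fun w => tnth (gamma n j.+1 w) l) = X n (j.+1, val l).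
    by apply/funext => w /=; rewrite (tnth_nth 0).
  apply: others_X; first by split => //=; exact: ltn_ord.
  by move=> [] /eqP; rewrite (negbTE lk).
have mX' : forall i, D n i -> measurable_fun setT (X n i) by move=> i; exact: mX.
have gX := gamma_law Z_gamma n2 Di0.
have sb := @small_ball_independent _ _ _ P _ _ _ (D n) (X n) _ _ (Z n 0)
  mX' (mZ0 n2) (gamma_independent Z_gamma n2) (gamma_indep_Z0 Z_gamma n2)
  (j.+1, k) id V dl (C * (3 * dl) `^ al) Di0 dl0 (@measurable_id _ _ _) mV _.
set S := [set w | `|X n (j.+1, k) w + V w| < dl].
have PS : (P S <= (C * (3 * dl) `^ al)%:E)%E.
  apply: sb => u.
  by have := HC _ u (3 * dl) gX; apply; rewrite mulr_gt0.
have mV' : measurable_fun setT V.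
  move=> _ B mB; have := mV measurableT B mB.
  exact: (measurable_others mX' (mZ0 n2)).
have mS : measurable S.
  have -> : S = (fun w => X n (j.+1, k) w + V w) @^-1` `](-dl), dl[%classic.
    by apply/seteqP; split => w /=; rewrite /S/= in_itv/= ltr_norml.
  rewrite -[_ @^-1` _]setTI; apply: measurable_funD => //; exact: mX.
have HS := holds_outside_compl mS PS (fun w h => h).
apply: holds_outside_sub (holds_outside_and HS (ae_holds_outside ZZt)).
  by rewrite addr0.
move=> w [nS ZE]; rewrite ZE leNgt; apply/negP => h; apply: nS; exact: h.
Qed.

Lemma weights_gt0 n j : (2 <= n)%N -> (j < m n)%N ->
  holds_outside P 0 (fun w => forall k, (k < n - j)%N -> 0 < (gamma n j.+1 w)`_k).
Proof.
move=> n2 jm.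
apply: holds_outside_sub (@holds_outside_forall_lt _ _ _ P (n - j) 0
  (fun k w => 0 < (gamma n j.+1 w)`_k) _); [by rewrite mulr0|by []|].
move=> k kN; have Di0 : D n (j.+1, k) by split => //=.
have gX := gamma_law Z_gamma n2 Di0.
apply: (@holds_outside_compl _ _ _ _ _ _ (X n (j.+1, k) @^-1` `]-oo, 0])).
- rewrite -[_ @^-1` _]setTI; exact: mX.
- by rewrite (gamma_le0 gX).
- by move=> w /=; rewrite in_itv/= => /negP; rewrite -ltNge.
Qed.

Lemma weights_le n j (T C : R) : (2 <= n)%N -> (j < m n)%N -> 0 < T ->
  (forall X T, gamma_distributed P (beta / 2) X -> 0 < T ->
    (P (X @^-1` `]T, +oo[) <= (C / T)%:E)%E) ->
  holds_outside P ((n - j)%:R * (C / T))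
    (fun w => forall k, (k < n - j)%N -> (gamma n j.+1 w)`_k <= T).
Proof.
move=> n2 jm T0 HC; apply: holds_outside_forall_lt => k kN.
have Di0 : D n (j.+1, k) by split => //=.
have gX := gamma_law Z_gamma n2 Di0.
apply: (@holds_outside_compl _ _ _ _ _ _ (X n (j.+1, k) @^-1` `]T, +oo[)).
- rewrite -[_ @^-1` _]setTI; exact: mX.
- exact: HC.
- by move=> w /=; rewrite in_itv/= andbT => /negP; rewrite -leNgt.
Qed.

(** Markov's inequality for the smallest modulus. *)
Lemma zero_near n j (b M : R) : (2 <= n)%N -> (j < m n)%N -> (j < n)%N -> 0 < b ->
  ('E_P[fun w => min_modulus (Z n j w)] <= M%:E)%E ->
  holds_outside P (M / b) (fun w => exists2 k, (k < n - j)%N & nc (Z n j w)`_k <= b).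
Proof.
move=> n2 jm jn b0 EM.
have mM := measurable_min_modulus (Z_measurable Z_gamma n2 (ltnW jm)).
set f := (fun w => min_modulus _) in mM.
pose E := f @^-1` `[b, +oo[%classic.
have mE : measurable E by rewrite -[E]setTI; exact: mM.
apply: (holds_outside_compl mE).
  rewrite EFinM lee_pdivlMr// muleC -integral_cst//.
  apply: le_trans EM; rewrite unlock.
  apply: (@le_trans _ _ (\int[P]_(w in E) (f w)%:E)%E).
    apply: ge0_le_integral => //.
    - by move=> w _; rewrite lee_fin ltW.
    - apply/measurable_EFinP; exact: measurable_funTS.
    - by move=> w; rewrite /E/= in_itv/= andbT lee_fin.
  apply: ge0_subset_integral => //.
  - by apply/measurable_EFinP.
  - by move=> w _; rewrite lee_fin min_modulus_ge0.
move=> w nE; apply: contrapT => H; apply: nE; rewrite /E/= in_itv/= andbT.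
apply: min_modulus_ge; first by rewrite size_tuple subn_gt0.
move=> x /(nthP 0)[k]; rewrite size_tuple => kN <-.
rewrite leNgt; apply/negP => h; apply: H; exists k => //; exact: ltW.
Qed.

End LevelEvents.

(** * Almost sure control of the iterated derivatives *)

Section StepBound.
Context (R : realType) (d : measure_display) (Omega : measurableType d).
Context (P : probability Omega R) (beta : R) (m : nat -> nat).
Context (gamma : forall n j, Omega -> (n.+1 - j).-tuple R).
Context (Z : forall n j, Omega -> (n - j).-tuple (borelC R)).
Hypothesis Z_gamma : iterated_randomized_derivatives P beta m gamma Z.
Hypothesis m_bounds : forall n, (2 <= n)%N -> (1 <= m n <= n - 1)%N.
Local Notation nc := (@Normc.normc R).

(** Let z_k be a point of modulus at most b.  Multiplying [pole_sum] by x - z_k,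
    which is at most |c| + 2r + b, isolates g_k plus the offset, of size at
    least dl; the total weight is at most n T. *)
Lemma pole_sum_ge (c x : R[i]) (r T b dl : R) (n : nat) (g : seq R) (z : seq R[i]) :
  (0 < size z <= n)%N -> 0 < r -> 0 < T -> 0 < b -> 0 < dl ->
  (forall k, (k < size z)%N -> 0 < g`_k) ->
  (forall k, (k < size z)%N -> g`_k <= T) ->
  (exists2 k, (k < size z)%N & nc z`_k <= b) ->
  nc (x - c) <= 2 * r -> x \notin z ->
  (forall k, (k < size z)%N -> dl <= `|g`_k + offset x g z k|) ->
  dl / ((nc c + 2 * r + b) * (n%:R * T)) * (\sum_(k < size z) g`_k) <= nc (pole_sum g z x).
Proof.
move=> /andP[z0 zn] r0 T0 b0 dl0 g0 gT [k kz zb] xc xz H.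
have n0 : 0 < n%:R :> R by rewrite ltr0n (leq_trans z0).
have c0 := modulus_ge0 c.
have A0 : 0 < nc c + 2 * r + b by lra.
have S0 : \sum_(k < size z) g`_k <= n%:R * T.
  apply: (@le_trans _ _ (\sum_(k < size z) T)).
    by apply: ler_sum => i _; exact: gT.
  by rewrite sumr_const card_ord -[leLHS]mulr_natl ler_wpM2r ?(ltW T0)// ler_nat.
have dF : dl <= (nc c + 2 * r + b) * nc (pole_sum g z x).
  apply: (le_trans (H k kz)); rewrite offset_pole_sum//.
  apply: (le_trans (le_Re_modulus _)); rewrite Normc.normcM.
  rewrite ler_wpM2r ?modulus_ge0//.
  apply: (le_trans (modulusD_le _ _)); rewrite modulusN lerD//.
  rewrite -(subrK c x); apply: (le_trans (modulusD_le _ _)); lra.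
rewrite mulrAC ler_pdivrMr ?mulr_gt0//.
have F0 := modulus_ge0 (pole_sum g z x).
apply: (@le_trans _ _ (((nc c + 2 * r + b) * nc (pole_sum g z x)) * (n%:R * T))).
  apply: ler_pM => //; first exact: ltW.
  by apply: sumr_ge0 => i _; exact/ltW/g0.
by rewrite le_eqVlt; apply/orP; left; apply/eqP; ring.
Qed.

Lemma step_holds_outside (c : R[i]) (r T b dl M CT Cs al : R) n j :
  (2 <= n)%N -> (j < m n)%N -> 0 < r -> 0 < T -> 0 < b -> 0 < dl ->
  (forall X T, gamma_distributed P (beta / 2) X -> 0 < T ->
    (P (X @^-1` `]T, +oo[) <= (CT / T)%:E)%E) ->
  (forall X u h, gamma_distributed P (beta / 2) X -> 0 < h ->
    (P (X @^-1` `[u, (u + h)%R]) <= (Cs * h `^ al)%:E)%E) ->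
  ('E_P[fun w => min_modulus (Z n j w)] <= M%:E)%E ->
  let eps := dl / ((nc c + 2 * r + b) * (n%:R * T)) in
  holds_outside P
    ((n - j)%:R * (CT / T) + M / b +
      n.*2%:R * (n%:R * ((n - j)%:R * (Cs * (3 * dl) `^ al))))
    (fun w => `|\sum_(a <- Z n j.+1 w) logmax c r a - \sum_(a <- Z n j w) logmax c r a|
      <= `|ln eps| + `|ln (32 * n%:R ^+ 2 / r)| + 2 * ln (16 * n%:R)).
Proof.
move=> n2 jm r0 T0 b0 dl0 HCT HCs EM eps.
have n0 : (0 < n)%N by rewrite ltnW.
have jn : (j < n)%N.
  by have /andP[_ mn] := m_bounds n2; rewrite (leq_trans jm)// (leq_trans mn)// leq_subr.
have h1 := weights_gt0 Z_gamma n2 jm.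
have h2 := weights_le Z_gamma n2 jm T0 HCT.
have h3 := zero_near Z_gamma n2 jm jn b0 EM.
have h4 : holds_outside P (n.*2%:R * (n%:R * ((n - j)%:R * (Cs * (3 * dl) `^ al))))
  (fun w => forall k, (k < n.*2)%N -> forall x, x \in grid c r n k ->
     forall l, (l < n - j)%N ->
     dl <= `|(gamma n j.+1 w)`_l + offset x (gamma n j.+1 w) (Z n j w) l|).
  apply: holds_outside_forall_lt => k _.
  rewrite -{1}(size_grid c r k n0).
  apply: holds_outside_forall_in => x _.
  apply: holds_outside_forall_lt => l lN.
  exact: (weight_small_ball Z_gamma).
have h5 := ae_holds_outside (Z_zeros Z_gamma n2 jm).
apply: holds_outside_sub (holds_outside_and (holds_outside_and h1 h5)
  (holds_outside_and (holds_outside_and h2 h3) h4)); first by lra.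
move=> w [[g0 zz] [[gT zb] away]].
have sZ : size (Z n j w) = (n - j)%N by rewrite size_tuple.
have sG : size (gamma n j.+1 w) = (n - j)%N by rewrite size_tuple.
have eps0 : 0 < eps.
  rewrite divr_gt0// !mulr_gt0 ?ltr0n//.
  by have := modulus_ge0 c; lra.
apply: (randomized_derivative_logmax r0 _ _ _ _ zz eps0).
- by rewrite sZ subn_gt0 jn leq_subr.
- by rewrite sZ size_tuple subnS.
- move=> k; have [kN|kN] := ltnP k (n - j); first exact/ltW/g0.
  by rewrite nth_default// sG.
- have k0 : (0 < n - j)%N by rewrite subn_gt0.
  rewrite sZ (bigD1 (Ordinal k0))//=; apply: ltr_pwDl; first exact: g0.
  by apply: sumr_ge0 => i _; exact/ltW/g0.
- move=> k x kn xg xZ; apply: pole_sum_ge => //; rewrite ?sZ//.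
  + by rewrite subn_gt0 jn leq_subr.
  + exact: modulus_grid_le xg.
  + by move=> l lN; exact: (away k).
Qed.

Lemma ln_poly_le (lo A : R) (q : nat) : 0 < lo -> 0 < A -> exists K : R,
  forall (n : nat) y, (2 <= n)%N -> lo <= y -> y <= A * n%:R ^+ q ->
    `|ln y| <= K * ln n%:R.
Proof.
move=> lo0 A0; have l2 : 0 < ln 2 :> R by rewrite ln_gt0// ltr1n.
exists ((`|ln lo| + `|ln A|) / ln 2 + q%:R) => n y n2 loy yA.
have y0 : 0 < y by exact: lt_le_trans loy.
have n0 : 0 < n%:R :> R by rewrite ltr0n ltnW.
have l2n : ln 2 <= ln n%:R :> R by rewrite ler_ln ?posrE// ler_nat.
have h1 : ln lo <= ln y by rewrite ler_ln ?posrE.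
have h2 : ln y <= ln A + q%:R * ln n%:R.
  rewrite mulr_natl -lnXn// -lnM ?posrE ?exprn_gt0// ler_ln ?posrE//.
  by rewrite mulr_gt0// exprn_gt0.
have h3 : `|ln lo| + `|ln A| <= (`|ln lo| + `|ln A|) / ln 2 * ln n%:R.
  by rewrite mulrAC ler_pdivlMr// ler_wpM2l// addr_ge0.
have h4 : 0 <= q%:R * ln n%:R :> R by rewrite mulr_ge0// (le_trans (ltW l2)).
have h5 := ler_norm (ln A); have h6 := ler_norm (- ln lo).
rewrite normrN in h6; have h7 := normr_ge0 (ln A); have h8 := normr_ge0 (ln lo).
by rewrite mulrDl ler_norml; apply/andP; split; lra.
Qed.

End StepBound.

Section LevelBound.
Context (R : realType) (d : measure_display) (Omega : measurableType d).
Context (P : probability Omega R) (beta : R) (m : nat -> nat).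
Context (gamma : forall n j, Omega -> (n.+1 - j).-tuple R).
Context (Z : forall n j, Omega -> (n - j).-tuple (borelC R)).
Hypothesis beta_gt0 : 0 < beta.
Hypothesis Z_gamma : iterated_randomized_derivatives P beta m gamma Z.
Hypothesis m_bounds : forall n, (2 <= n)%N -> (1 <= m n <= n - 1)%N.
Local Notation nc := (@Normc.normc R).

Lemma moment_bound_real (B : R) :
  (ereal_sup
     [set (n%:R `^ (- B))%:E *
          ereal_sup [set 'E_P[fun w => min_modulus (Z n j w)]
                    | j in [set j | (j <= m n - 1)%N]]
     | n in [set n | (2 <= n)%N]] < +oo)%E ->
  exists2 M : R, 0 <= M & forall n j, (2 <= n)%N -> (j < m n)%N ->
    ('E_P[fun w => min_modulus (Z n j w)] <= (M * n%:R `^ B)%:E)%E.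
Proof.
set s := ereal_sup _ => slt.
have [M M0 sM] : exists2 M : R, 0 <= M & (s <= M%:E)%E.
  move: slt; case: s => [t| |]//= _; last by exists 0; rewrite ?leNye.
  by exists `|t| => //; rewrite lee_fin ler_norm.
exists M => // n j n2 jm.
set t := ereal_sup [set 'E_P[fun w => min_modulus (Z n j w)]%E | j in [set j | (j <= m n - 1)%N]].
have h1 : ('E_P[fun w => min_modulus (Z n j w)] <= t)%E.
  by apply: ereal_sup_ubound; exists j => //=; rewrite subn1 -ltnS (ltn_predK jm).
have h2 : ((n%:R `^ (- B))%:E * t <= M%:E)%E.
  by apply: le_trans sM; apply: ereal_sup_ubound; exists n.
have n0 : 0 < n%:R :> R by rewrite ltr0n ltnW.
have p0 : 0 < n%:R `^ B :> R by rewrite powR_gt0.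
apply: (le_trans h1); rewrite EFinM muleC -lee_pdivrMl//.
by rewrite -powRN.
Qed.

(** All thresholds are powers of n: weights below n^5, one zero of modulus below
    n^B' with B' >= B + 3, small-ball radius n^(-p)/3 with p al >= 6.  Then
    each of the at most n steps fails with probability O(n^-3), and the
    logarithm of the resulting lower bound is O(log n). *)
Lemma steps_holds_outside (c : R[i]) (r B M : R) : 0 < r -> 0 <= M ->
  (forall n j, (2 <= n)%N -> (j < m n)%N ->
    ('E_P[fun w => min_modulus (Z n j w)] <= (M * n%:R `^ B)%:E)%E) ->
  exists K C : R, forall n, (2 <= n)%N ->
    holds_outside P (C / n%:R ^+ 2) (fun w => forall j, (j < m n)%N ->
    `|\sum_(a <- Z n j.+1 w) logmax c r a - \sum_(a <- Z n j w) logmax c r a|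
      <= K * ln n%:R).
Proof.
move=> r0 M0 EM; have b20 : 0 < beta / 2 by rewrite divr_gt0.
have [CT HCT] := gamma_tail_le P b20.
have [al al0 [Cs HCs]] := gamma_small_interval_le P b20.
have [B' HB'] : exists B' : nat, B + 3 <= B'%:R.
  by exists (Num.trunc (B + 3)).+1; exact/ltW/truncnS_gt.
have [p Hp] : exists p : nat, 6 <= p%:R * al.
  exists (Num.trunc (6 / al)).+1; rewrite -ler_pdivrMr//; exact/ltW/truncnS_gt.
set A0 := nc c + 2 * r; have A00 : 0 < A0 by have := modulus_ge0 c; rewrite /A0; lra.
have [K1 HK1] := @ln_poly_le R (6 * r) (3 * (A0 + 1)) (p + B' + 6)%N ltac:(lra) ltac:(lra).
have r32 : 0 < 32 / r by rewrite divr_gt0.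
have [K2 HK2] := @ln_poly_le R (32 / r) (32 / r) 2 r32 r32.
have [K3 HK3] := @ln_poly_le R 16 16 1 ltac:(lra) ltac:(lra).
exists (K1 + K2 + 2 * K3), (`|CT| + M + 2 * `|Cs|) => n n2.
have n0 : 0 < n%:R :> R by rewrite ltr0n ltnW.
have n1 : 1 <= n%:R :> R by rewrite ler1n ltnW.
have X0 q : 0 < n%:R ^+ q :> R by rewrite exprn_gt0.
have X1 q : 1 <= n%:R ^+ q :> R by rewrite exprn_ege1.
have /andP[_ mn] := m_bounds n2.
pose T : R := n%:R ^+ 5; pose b : R := n%:R ^+ B'; pose dl : R := (3 * n%:R ^+ p)^-1.
have dl0 : 0 < dl by rewrite invr_gt0 mulr_gt0.
set C := `|CT| + M + 2 * `|Cs|.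
have step j : (j < m n)%N -> holds_outside P (C / n%:R ^+ 3) (fun w =>
    `|\sum_(a <- Z n j.+1 w) logmax c r a - \sum_(a <- Z n j w) logmax c r a|
      <= (K1 + K2 + 2 * K3) * ln n%:R).
  move=> jm.
  have := step_holds_outside Z_gamma m_bounds c n2 jm r0 (X0 5) (X0 B') dl0 HCT HCs (EM _ _ n2 jm).
  apply: holds_outside_sub.
    have Nn : (n - j)%:R <= n%:R :> R by rewrite ler_nat leq_subr.
    have N0 : 0 <= (n - j)%:R :> R by [].
    (* n - j weights, each above n^5 with probability at most CT / n^5 *)
    have e1 : (n - j)%:R * (CT / n%:R ^+ 5) <= `|CT| / n%:R ^+ 3.
      apply: (@le_trans _ _ (n%:R * (`|CT| / n%:R ^+ 5))).
        apply: (@le_trans _ _ ((n - j)%:R * (`|CT| / n%:R ^+ 5))).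
          by rewrite ler_wpM2l// ler_wpM2r ?invr_ge0 ?(ltW (X0 _))// ler_norm.
        by rewrite ler_wpM2r// divr_ge0// ltW.
      have -> : n%:R * (`|CT| / n%:R ^+ 5) = `|CT| / n%:R ^+ 4.
        by field; rewrite gt_eqF.
      by rewrite ler_wpM2l// lef_pV2 ?posrE// ler_weXn2l.
    (* no zero of modulus below n^B' *)
    have e2 : M * n%:R `^ B / n%:R ^+ B' <= M / n%:R ^+ 3.
      rewrite -mulrA ler_wpM2l// ler_pdivrMr// mulrC ler_pdivlMr//.
      rewrite -!powR_mulrn ?(ltW n0)// -powRD ?(gt_eqF n0) ?implybT//.
      by rewrite ler_powR.
    (* 2n levels, n grid points and n - j poles *)
    have e3 : n.*2%:R * (n%:R * ((n - j)%:R * (Cs * (3 * dl) `^ al))) <= 2 * `|Cs| / n%:R ^+ 3.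
      have -> : 3 * dl = (n%:R ^+ p)^-1.
        by rewrite /dl invfM mulrA mulfV ?mul1r.
      have Y : (n%:R ^+ p)^-1 `^ al <= (n%:R ^+ 6)^-1 :> R.
        rewrite -powR_inv1 ?(ltW (X0 _))// -!powRrM mulN1r powRN.
        rewrite lef_pV2 ?posrE ?powR_gt0// -!powR_mulrn ?(ltW n0)// -powRrM.
        by rewrite ler_powR.
      have Y0 : 0 <= (n%:R ^+ p)^-1 `^ al :> R by exact: powR_ge0.
      have -> : 2 * `|Cs| / n%:R ^+ 3 = n.*2%:R * (n%:R * (n%:R * (`|Cs| * (n%:R ^+ 6)^-1))).
        by rewrite -mul2n natrM; field; rewrite gt_eqF.
      rewrite ler_wpM2l// ler_wpM2l// ?(ltW n0)//.
      apply: (@le_trans _ _ ((n - j)%:R * (`|Cs| * (n%:R ^+ 6)^-1))).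
        rewrite ler_wpM2l//; apply: (@le_trans _ _ (`|Cs| * (n%:R ^+ p)^-1 `^ al)).
          by rewrite ler_wpM2r// ler_norm.
        by rewrite ler_wpM2l.
      by rewrite ler_wpM2r// mulr_ge0// invr_ge0 ltW.
    apply: (le_trans (lerD (lerD e1 e2) e3)).
    by rewrite /C (mulrDl (`|CT| + M)) (mulrDl `|CT|).
  move=> w /le_trans; apply.
  rewrite (mulrDl (K1 + K2)) (mulrDl K1) -(mulrA 2 K3).
  apply: lerD; [apply: lerD|].
  - set eps := dl / _; have -> : `|ln eps| = `|ln eps^-1|.
      rewrite lnV ?normrN// posrE /eps divr_gt0// !mulr_gt0//.
      by rewrite addr_gt0// X0.
    have -> : eps^-1 = 3 * n%:R ^+ p * (A0 + n%:R ^+ B') * (n%:R ^+ 6).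
      rewrite /eps invf_div /dl invrK -/A0 [n%:R ^+ 6]exprS; ring.
    apply: HK1 => //.
      have h : 2 * r <= A0 + n%:R ^+ B'.
        by have := X1 B'; have := modulus_ge0 c; rewrite /A0; lra.
      have h' : 3 * (2 * r) <= 3 * n%:R ^+ p * (A0 + n%:R ^+ B').
        apply: ler_pM => //; [lra|have := X1 p; lra].
      rewrite (_ : 6 * r = 3 * (2 * r)); last by ring.
      by apply: (le_trans h'); rewrite ler_peMr//; lra.
    have h : A0 + n%:R ^+ B' <= (A0 + 1) * n%:R ^+ B'.
      by rewrite mulrDl mul1r lerD2r ler_peMr// ltW.
    rewrite !exprD [leRHS](_ : _ = 3 * n%:R ^+ p * ((A0 + 1) * n%:R ^+ B') * n%:R ^+ 6); last by ring.
    by rewrite ler_wpM2r ?(ltW (X0 _))// ler_wpM2l// mulr_ge0// ltW.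
  - rewrite [32 * _ / r]mulrAC; apply: HK2 => //.
    by rewrite ler_peMr// ltW.
  - rewrite ler_wpM2l//; apply: le_trans (HK3 n (16 * n%:R) n2 _ _); first exact: ler_norm.
      by rewrite ler_peMr.
    by rewrite expr1.
have C0 : 0 <= C / n%:R ^+ 3.
  by have /andP[m1 _] := m_bounds n2; exact: holds_outside_ge0 (step 0%N m1).
apply: holds_outside_sub (holds_outside_forall_lt step); last by [].
apply: (@le_trans _ _ (n%:R * (C / n%:R ^+ 3))).
  by rewrite ler_wpM2r// ler_nat (leq_trans mn)// leq_subr.
by rewrite le_eqVlt; apply/orP; left; apply/eqP; field; rewrite gt_eqF.
Qed.

(** Borel-Cantelli applied to all the steps at once, then telescoping. *)
Lemma logmax_sums_close (c : R[i]) (r B M : R) : 0 < r -> 0 <= M ->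
  (forall n j, (2 <= n)%N -> (j < m n)%N ->
    ('E_P[fun w => min_modulus (Z n j w)] <= (M * n%:R `^ B)%:E)%E) ->
  exists K : R, {ae P, forall w, exists N, forall n, (N <= n)%N ->
    `|\sum_(a <- Z n (m n) w) logmax c r a - \sum_(a <- Z n 0 w) logmax c r a|
      <= (m n)%:R * (K * ln n%:R)}.
Proof.
move=> r0 M0 EM; have [K [C H]] := steps_holds_outside c r0 M0 EM.
exists K; apply: filterS (holds_outside_eventually H) => w [N HN].
exists N => n /HN {}HN.
pose s j := \sum_(a <- Z n j w) logmax c r a.
have : forall j, (j <= m n)%N -> `|s j - s 0%N| <= j%:R * (K * ln n%:R).
  elim => [|j IH] jm; first by rewrite subrr normr0 mul0r.
  rewrite -natr1 mulrDl mul1r [leRHS]addrC -(subrKA (s j)).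
  apply: (le_trans (ler_normD _ _)); apply: lerD; first exact: HN.
  exact/IH/ltnW.
by apply.
Qed.

End LevelBound.

(** * Bumps made of circle potentials *)

Section Bump.
Context {R : realType}.
Implicit Types (a b c : R[i]) (r : R).
Local Notation nc := (@Normc.normc R).

(** ln 2 on the disc of radius r, null outside the disc of radius 2r. *)
Definition disc_bump c r a : R := logmax c (2 * r) a - logmax c r a.

Lemma disc_bump_ge0 c r a : 0 < r -> 0 <= disc_bump c r a.
Proof.
move=> r0; rewrite subr_ge0 ler_ln ?posrE ?max_modulus_gt0 ?mulr_gt0//.
by rewrite ge_max !le_max lexx/=; apply/orP; right; lra.
Qed.

Lemma disc_bump_le c r a : 0 < r -> disc_bump c r a <= ln 2.
Proof.
move=> r0; rewrite lerBlDr -lnM ?posrE ?max_modulus_gt0//.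
rewrite ler_ln ?posrE ?mulr_gt0 ?max_modulus_gt0 ?mulr_gt0//.
have a0 := modulus_ge0 (a - c); rewrite ge_max; apply/andP; split.
  by apply: (@le_trans _ _ (2 * nc (a - c))); [lra|rewrite ler_pM2l// le_max lexx].
by rewrite ler_pM2l// le_max lexx orbT.
Qed.

Lemma disc_bump_far c r a : 0 < r -> 2 * r <= nc (a - c) -> disc_bump c r a = 0.
Proof. by move=> r0 h; rewrite /disc_bump /logmax !max_l ?subrr//; lra. Qed.

Lemma disc_bump_near c r a : 0 < r -> nc (a - c) <= r -> disc_bump c r a = ln 2.
Proof.
move=> r0 h; rewrite /disc_bump /logmax !max_r//; last by lra.
by rewrite lnM ?posrE// addrK.
Qed.

Lemma ln_lipschitz (x y r : R) : 0 < r -> r <= x -> r <= y ->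
  `|ln x - ln y| <= r^-1 * `|x - y|.
Proof.
move=> r0; wlog xy : x y / y <= x.
  move=> W rx ry; have [yx|xy] := leP y x; first exact: W.
  by rewrite distrC (distrC x y); apply: W => //; exact: ltW.
move=> rx ry; have y0 : 0 < y by exact: lt_le_trans ry.
have x0 : 0 < x by exact: lt_le_trans xy.
rewrite !ger0_norm ?subr_ge0 ?ler_ln ?posrE//.
rewrite -ln_div ?posrE//.
apply: (@le_trans _ _ (x / y - 1)).
  have -> : x / y = 1 + (x / y - 1) by ring.
  apply: (le_trans (le_ln1Dx _)); last by lra.
  rewrite ltrBrDl addrN divr_gt0//.
have -> : x / y - 1 = y^-1 * (x - y) by field; rewrite gt_eqF.
by rewrite ler_wpM2r ?subr_ge0// lef_pV2.
Qed.

Lemma logmax_lipschitz c r a b : 0 < r ->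
  `|logmax c r a - logmax c r b| <= r^-1 * nc (a - b).
Proof.
move=> r0; apply: (le_trans (ln_lipschitz r0 _ _)); rewrite ?le_max ?lexx ?orbT//.
rewrite ler_wpM2l ?invr_ge0 ?(ltW r0)//.
have h1 := modulus_dist_dist (a - c) (b - c).
have h2 := modulus_dist_dist (b - c) (a - c).
rewrite (_ : a - c - (b - c) = a - b) in h1; last by ring.
rewrite (_ : b - c - (a - c) = b - a) in h2; last by ring.
rewrite (modulus_distC b a) in h2; rewrite ler_norml.
by case: (leP (nc (a - c)) r) => ?; case: (leP (nc (b - c)) r) => ?; apply/andP; split; lra.
Qed.

Lemma disc_bump_lipschitz c r a b : 0 < r ->
  `|disc_bump c r a - disc_bump c r b| <= 2 * r^-1 * nc (a - b).
Proof.
move=> r0; have h1 := @logmax_lipschitz c (2 * r) a b ltac:(lra).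
have h2 := @logmax_lipschitz c r a b r0.
rewrite (_ : disc_bump c r a - disc_bump c r b =
  (logmax c (2 * r) a - logmax c (2 * r) b) - (logmax c r a - logmax c r b)); last first.
  by rewrite /disc_bump; ring.
apply: (le_trans (ler_normB _ _)); apply: (le_trans (lerD h1 h2)).
have : (2 * r)^-1 <= r^-1 by rewrite lef_pV2 ?posrE ?mulr_gt0//; lra.
by move=> /(ler_wpM2r (modulus_ge0 (a - b))); lra.
Qed.

End Bump.

Section UniformContinuity.
Context {R : realType}.
Implicit Types (a b c : R[i]).
Local Notation nc := (@Normc.normc R).

Lemma modulus_le_ReIm a : nc a <= `|complex.Re a| + `|complex.Im a|.
Proof.
case: a => u v /=; rewrite -[leRHS]ger0_norm ?addr_ge0// -sqrtr_sqr ler_wsqrtr//.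
by rewrite sqrrD !real_normK ?num_real// addrAC lerDl mulrn_wge0// mulr_ge0.
Qed.

Lemma continuous_complex : continuous (fun p : R * R => (p.1 +i* p.2)%C : R[i]^o).
Proof.
move=> p A /nbhs_modulusP[e e0 eA].
have e20 : 0 < e / 2 by rewrite divr_gt0.
apply/nbhs_ballP; exists (e / 2) => // q [/= q1 q2]; apply: eA.
apply: (le_lt_trans (modulus_le_ReIm _)).
move: p q q1 q2 => [p1 p2] [q1 q2]; rewrite /ball /= => h1 h2; lra.
Qed.

Lemma square_compact (L : R) :
  compact [set a : R[i]^o | `|complex.Re a| <= L /\ `|complex.Im a| <= L].
Proof.
have := @continuous_compact _ _ (fun p : R * R => (p.1 +i* p.2)%C : R[i]^o)
  (`[-L, L]%classic `*` `[-L, L]%classic).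
rewrite (_ : _ @` _ = [set a : R[i]^o | `|complex.Re a| <= L /\ `|complex.Im a| <= L]).
  apply; first exact: continuous_subspaceT continuous_complex.
  by apply: compact_setX; exact: segment_compact.
apply/seteqP; split.
  by move=> _ [[x y] [/= hx hy] <-] /=; rewrite !in_itv/= -!ler_norml in hx hy *.
move=> [x y] [/= hx hy]; exists (x, y) => //=; rewrite !in_itv/= -!ler_norml.
by split.
Qed.

(** Compactness in its near-covering form, the radius dl being the parameter
    that tends to 0. *)
Lemma unif_continuous_square (f : R[i]^o -> R) (L e : R) : continuous f -> 0 < e ->
  exists2 dl : R, 0 < dl & forall a b, `|complex.Re a| <= L -> `|complex.Im a| <= L ->
    nc (a - b) < dl -> `|f a - f b| < e.
Proof.
move=> cf e0.
have /compact_near_coveringP/(_ R (0^'+) (fun dl a =>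
  forall b, nc (a - b) < dl -> `|f a - f b| < e) _) := @square_compact L.
move=> H.
have {H} : \forall dl \near 0^'+, [set a : R[i]^o | `|complex.Re a| <= L /\ `|complex.Im a| <= L]
    `<=` (fun a => forall b, nc (a - b) < dl -> `|f a - f b| < e).
  apply: H => x _.
  have e20 : 0 < e / 2 by rewrite divr_gt0.
  have [eta eta0 fx] : exists2 eta : R, 0 < eta & forall b, nc (x - b) < eta ->
      `|f x - f b| < e / 2.
    have /(@cvgrPdist_lt _ _ _ _ (nbhs_filter (x : R[i]^o))) /(_ _ e20) := cf x.
    by move=> /nbhs_modulusP.
  have eta20 : 0 < eta / 2 by rewrite divr_gt0.
  exists ([set b | nc (x - b) < eta / 2], [set dl | dl < eta / 2]).
    split => /=; first exact: nbhs_modulus.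
    by apply: nbhs_right_lt.
  move=> [a dl] [/= xa dle] b ab.
  have h1 : `|f x - f a| < e / 2 by apply: fx; lra.
  have h2 : `|f x - f b| < e / 2.
    apply: fx; rewrite -(subrKA a); apply: (le_lt_trans (modulusD_le _ _)); lra.
  rewrite -(subrKA (f x)); apply: (le_lt_trans (ler_normD _ _)).
  by rewrite distrC; lra.
move=> H.
near (0 : R)^'+ => dl.
exists dl => // a b ra ia ab; apply: (near H dl) => //.
Unshelve. all: by end_near.
Qed.

End UniformContinuity.

(** * Approximation by lattices of bumps *)

Section Lattice.
Context {R : realType}.
Implicit Types (a b c : R[i]) (F : R[i] -> R).
Local Notation nc := (@Normc.normc R).

Definition unif_cont F := forall e : R, 0 < e ->
  exists2 dl : R, 0 < dl & forall a b, nc (a - b) < dl -> `|F a - F b| < e.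

Lemma lipschitz_unif_cont F (K : R) :
  (forall a b, `|F a - F b| <= K * nc (a - b)) -> unif_cont F.
Proof.
move=> FK e e0; have K0 : 0 < `|K| + 1 by rewrite ltr_wpDl.
exists (e / (`|K| + 1)); first by rewrite divr_gt0.
move=> a b; rewrite ltr_pdivlMr// mulrC; apply: le_lt_trans.
apply: (le_trans (FK _ _)); rewrite ler_wpM2r ?modulus_ge0//.
by rewrite (le_trans (ler_norm _))// lerDl.
Qed.

Lemma unif_contB F G : unif_cont F -> unif_cont G -> unif_cont (fun a => F a - G a).
Proof.
move=> uF uG e e0; have e20 : 0 < e / 2 by rewrite divr_gt0.
have [d1 d10 h1] := uF _ e20; have [d2 d20 h2] := uG _ e20.
exists (Num.min d1 d2); first by rewrite lt_min d10 d20.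
move=> a b; rewrite lt_min => /andP[/h1 l1 /h2 l2].
rewrite (_ : _ - _ = (F a - F b) - (G a - G b)); last by ring.
by apply: (le_lt_trans (ler_normB _ _)); lra.
Qed.

Lemma unif_cont_max0 F : unif_cont F -> unif_cont (fun a => Num.max (F a) 0).
Proof.
move=> uF e e0; have [dl dl0 h] := uF e e0; exists dl => // a b /h.
by rewrite !ltr_norml => /andP[l1 l2]; case: (leP (F a) 0) => ?;
   case: (leP (F b) 0) => ?; apply/andP; split; lra.
Qed.

(** Two such indices differ by less than 8, so that they are determined by their
    residues modulo 9. *)
Lemma count_lattice_le (K N : nat) (h y : R) : 0 < h ->
  \sum_(u < K) (if `|y - (u%:R - N%:R) * h| < 4 * h then 1 else 0) <= 9 :> R.
Proof.
move=> h0; rewrite -big_mkcond sumr_const ler_nat.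
pose f (u : 'I_K) : 'I_9 := inord (u %% 9).
rewrite -(card_ord 9) -(@card_in_imset _ _ f); last first.
  move=> u v uP vP.
  have := uP : `|y - (u%:R - N%:R) * h| < 4 * h.
  have := vP : `|y - (v%:R - N%:R) * h| < 4 * h.
  rewrite !ltr_norml => /andP[v1 v2] /andP[u1 u2].
  move=> /(congr1 val); rewrite /f /= !inordK ?ltn_mod// => uv.
  have close (s t : nat) : (s%:R - N%:R) * h - (t%:R - N%:R) * h < 8 * h -> (s < t + 8)%N.
    rewrite -mulrBl ltr_pM2r// => H; rewrite -(ltr_nat R) natrD.
    by move: H; lra.
  have c1 : (u < v + 8)%N by apply: close; lra.
  have c2 : (v < u + 8)%N by apply: close; lra.
  by apply: val_inj => /=; lia.
exact: max_card.
Qed.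

(** The index is shifted by N: u and v run over 0, ..., 2N. *)
Definition lattice_point (h : R) (N u v : nat) : R[i] :=
  Complex ((u%:R - N%:R) * h) ((v%:R - N%:R) * h).

(** The bumps have radius 2h, twice the mesh: rounding down the coordinates of a
    gives a lattice point at distance at most 2h, where the bump is ln 2. *)
Definition lattice_sum (h : R) (N : nat) (w : R[i] -> R) a : R :=
  \sum_(u < N.*2.+1) \sum_(v < N.*2.+1)
    w (lattice_point h N u v) * disc_bump (lattice_point h N u v) (2 * h) a.

Lemma lattice_sum_le (h : R) N a : 0 < h -> lattice_sum h N (fun=> 1) a <= 81 * ln 2.
Proof.
move=> h0; have l2 : 0 < ln 2 :> R by rewrite ln_gt0// ltr1n.
pose I (y : R) (u : nat) : R := if `|y - (u%:R - N%:R) * h| < 4 * h then 1 else 0.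
apply: (@le_trans _ _ (\sum_(u < N.*2.+1) \sum_(v < N.*2.+1)
   I (complex.Re a) u * (I (complex.Im a) v * ln 2))).
  apply: ler_sum => u _; apply: ler_sum => v _; rewrite mul1r.
  have h20 : 0 < 2 * h by lra.
  have [far|near] := leP (2 * (2 * h)) (nc (a - lattice_point h N u v)).
    by rewrite disc_bump_far// /I; case: ifP => _; case: ifP => _; lra.
  have hr : `|complex.Re a - (u%:R - N%:R) * h| < 4 * h.
    have := le_Re_modulus (a - lattice_point h N u v).
    by rewrite raddfB /=; lra.
  have hi : `|complex.Im a - (v%:R - N%:R) * h| < 4 * h.
    have := le_Im_modulus (a - lattice_point h N u v).
    by rewrite raddfB /=; lra.
  by rewrite /I hr hi !mul1r disc_bump_le.
under eq_bigr do rewrite -mulr_sumr -mulr_suml.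
rewrite -mulr_suml mulrA ler_wpM2r ?(ltW l2)//.
have -> : (81 : R) = 9 * 9 by ring.
apply: ler_pM; rewrite ?count_lattice_le//;
  by apply: sumr_ge0 => i _; rewrite /I; case: ifP.
Qed.

Lemma lattice_sum_ge (h : R) (N : nat) a : 0 < h ->
  `|complex.Re a| <= N%:R * h -> `|complex.Im a| <= N%:R * h ->
  ln 2 <= lattice_sum h N (fun=> 1) a.
Proof.
move=> h0 ra ia.
have idx (y : R) : `|y| <= N%:R * h -> exists u : 'I_N.*2.+1,
    `|y - (u%:R - N%:R) * h| <= h.
  rewrite ler_norml => /andP[y1 y2]; pose t := y / h + N%:R.
  have t0 : 0 <= t by rewrite /t -lerBlDr sub0r ler_pdivlMr// mulNr.
  have tN : t <= N.*2%:R.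
    by rewrite /t -addnn natrD lerD2r ler_pdivrMr.
  have ut := truncn_le t; rewrite t0 in ut.
  have tu := truncnS_gt t.
  have uN : (Num.trunc t < N.*2.+1)%N by rewrite ltnS -(ler_nat R) (le_trans ut).
  exists (Ordinal uN) => /=; set u := Num.trunc t in ut tu *.
  rewrite -natr1 in tu.
  have -> : y - (u%:R - N%:R) * h = (t - u%:R) * h by rewrite /t; field; rewrite gt_eqF.
  by rewrite ger0_norm ?mulr_ge0 ?(ltW h0)//; [rewrite ler_piMl ?(ltW h0)//; lra|lra].
have [u hu] := idx _ ra; have [v hv] := idx _ ia.
have h20 : 0 < 2 * h by lra.
rewrite /lattice_sum (bigD1 u)//= (bigD1 v)//= mul1r disc_bump_near//; last first.
  apply: (le_trans (modulus_le_ReIm _)); rewrite !raddfB /=; lra.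
rewrite -addrA lerDl addr_ge0//.
  by apply: sumr_ge0 => i _; rewrite mul1r disc_bump_ge0.
by apply: sumr_ge0 => i _; apply: sumr_ge0 => j _; rewrite mul1r disc_bump_ge0.
Qed.

(** With this factor the sum of all the bumps of a lattice lies between 1/81 and
    1 on the square that the lattice covers. *)
Definition kappa : R := (81 * ln 2)^-1.

(** By uniform continuity F may be replaced by F a in the lattice sum at a, as
    only points at distance less than 4h contribute; then F - g is close to
    F (1 - kappa W) with 1/81 <= kappa W <= 1 on the support of F. *)
Lemma lattice_approx F (s L e : R) : unif_cont F ->
  (forall a, 0 <= F a <= s) ->
  (forall a, F a != 0 -> `|complex.Re a| <= L /\ `|complex.Im a| <= L) ->
  0 < e ->
  exists k N : nat, let h := k.+1%:R^-1 in
    (forall a, - e <= F a - kappa * lattice_sum h N F a <= (1 - 81%:R^-1) * s + e) /\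
    (forall a, kappa * lattice_sum h N F a != 0 ->
       `|complex.Re a| <= L + 1 /\ `|complex.Im a| <= L + 1).
Proof.
move=> uF Fs FL e0.
have l2 : 0 < ln 2 :> R by rewrite ln_gt0// ltr1n.
have k0 : 0 < kappa by rewrite invr_gt0 mulr_gt0.
have [dl dl0 Hdl] := uF e e0.
(* bumps are supported in discs of radius 4h: less than dl, and less than 1 so
   as to control the support of their sum *)
have [k hk] : exists k : nat, 4 * k.+1%:R^-1 < Num.min dl 1.
  have m0 : 0 < Num.min dl 1 by rewrite lt_min dl0 ltr01.
  exists (Num.trunc (4 / Num.min dl 1)).
  by rewrite ltr_pdivrMr// mulrC -ltr_pdivrMr// truncnS_gt.
set h : R := k.+1%:R^-1 in hk; have h0 : 0 < h by rewrite invr_gt0.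
have h20 : 0 < 2 * h by lra.
move: hk; rewrite lt_min => /andP[hdl h1].
have [N LN] : exists N : nat, L <= N%:R * h.
  by exists (Num.trunc (L / h)).+1; rewrite -ler_pdivrMr//; exact/ltW/truncnS_gt.
exists k, N; rewrite -/h => /=; split=> [a|a]; last first.
  rewrite mulf_eq0 gt_eqF//= => nz; apply: contrapT => H.
  move/negP: nz; apply; rewrite /lattice_sum big1// => u _; rewrite big1// => v _.
  set c := lattice_point _ _ _ _.
  have [->|Fc] := eqVneq (F c) 0; first by rewrite mul0r.
  have [rc ic] := FL _ Fc.
  have [far|near] := leP (2 * (2 * h)) (nc (a - c)); first by rewrite disc_bump_far// mulr0.
  exfalso; apply: H.
  have hr := le_Re_modulus (a - c); have hi := le_Im_modulus (a - c).
  rewrite raddfB /= in hr; rewrite raddfB /= in hi.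
  have t1 := ler_normD (complex.Re a - complex.Re c) (complex.Re c).
  have t2 := ler_normD (complex.Im a - complex.Im c) (complex.Im c).
  rewrite subrK in t1; rewrite subrK in t2; split; lra.
have /andP[Fa0 Fas] := Fs a.
set W := lattice_sum h N (fun=> 1) a.
have W81 : W <= 81 * ln 2 by exact: lattice_sum_le.
have W0 : 0 <= W.
  by apply: sumr_ge0 => u _; apply: sumr_ge0 => v _; rewrite mul1r disc_bump_ge0.
have kW1 : kappa * W <= 1 by rewrite /kappa mulrC ler_pdivrMr ?mul1r// mulr_gt0.
have close : `|kappa * lattice_sum h N F a - F a * (kappa * W)| <= e.
  have -> : kappa * lattice_sum h N F a - F a * (kappa * W) =
      kappa * (lattice_sum h N F a - F a * W) by ring.
  rewrite normrM (gtr0_norm k0).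
  apply: (@le_trans _ _ (kappa * (e * W))); last first.
    by rewrite mulrCA -[leRHS]mulr1 ler_wpM2l// ltW.
  rewrite ler_wpM2l ?(ltW k0)// /W /lattice_sum !mulr_sumr -sumrB.
  apply: (le_trans (ler_norm_sum _ _ _)); apply: ler_sum => u _.
  rewrite !mulr_sumr -sumrB.
  apply: (le_trans (ler_norm_sum _ _ _)); apply: ler_sum => v _.
  rewrite mul1r; set c := lattice_point _ _ _ _.
  have b0 : 0 <= disc_bump c (2 * h) a by exact: disc_bump_ge0.
  rewrite -mulrBl normrM (ger0_norm b0).
  have [far|near] := leP (2 * (2 * h)) (nc (a - c)); first by rewrite disc_bump_far// !mulr0.
  by rewrite ler_wpM2r//; apply/ltW/Hdl; rewrite modulus_distC; lra.
move: close; rewrite ler_norml => /andP[cl1 cl2].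
have FW : F a * (kappa * W) <= F a by rewrite ler_piMr.
apply/andP; split; first by lra.
have [Fz|Fnz] := eqVneq (F a) 0.
  have s0 : 0 <= s by lra.
  have q0 : 0 <= (1 - 81%:R^-1) * s by rewrite mulr_ge0//; lra.
  by rewrite Fz mul0r in cl1; rewrite Fz; lra.
have [ra ia] := FL _ Fnz.
have Wlo : ln 2 <= W by apply: lattice_sum_ge => //; exact: le_trans LN.
have kW : 81^-1 <= kappa * W.
  by rewrite /kappa invfM -mulrA ler_peMr ?invr_ge0// mulrC ler_pdivlMr ?mul1r.
have : F a * (1 - kappa * W) <= s * (1 - 81^-1).
  by apply: ler_pM => //; lra.
rewrite mulrBr mulr1; lra.
Qed.

End Lattice.

(** * Comparing averages over two sequences of configurations *)

Section Averages.
Context {R : realType}.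
Implicit Types (f g F : R[i] -> R) (z : seq R[i]).
Local Notation nc := (@Normc.normc R).

Definition average f z : R := (\sum_(a <- z) f a) / (size z)%:R.

Lemma average_le f z (s : R) : (forall a, `|f a| <= s) -> `|average f z| <= s.
Proof.
move=> fs; have s0 : 0 <= s by exact: le_trans (fs 0).
rewrite /average normrM normfV (ger0_norm (ler0n _ _)).
case: z => [|a z]; first by rewrite big_nil normr0 mul0r.
rewrite ler_pdivrMr ?ltr0n//; apply: (le_trans (ler_norm_sum _ _ _)).
apply: (@le_trans _ _ (\sum_(b <- a :: z) s)); first exact: ler_sum.
by rewrite big_const_seq count_predT iter_addr_0 mulr_natr.
Qed.

Lemma average_ge0 f z : (forall a, 0 <= f a) -> 0 <= average f z.
Proof. by move=> f0; rewrite divr_ge0// sumr_ge0. Qed.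

Lemma averageD f g z : average (fun a => f a + g a) z = average f z + average g z.
Proof. by rewrite /average big_split mulrDl. Qed.

Lemma averageZ (k : R) f z : average (fun a => k * f a) z = k * average f z.
Proof. by rewrite /average -mulr_sumr mulrA. Qed.

Lemma average_sum (I : Type) (s : seq I) (f : I -> R[i] -> R) z :
  average (fun a => \sum_(i <- s) f i a) z = \sum_(i <- s) average (f i) z.
Proof. by rewrite /average exchange_big mulr_suml. Qed.

Lemma cvg0_sum (I : Type) (s : seq I) (u : I -> nat -> R) :
  (forall i, u i n @[n --> \oo] --> (0 : R)) ->
  (\sum_(i <- s) u i n) @[n --> \oo] --> (0 : R).
Proof.
move=> ui; elim: s => [|i s IH].
  under eq_fun do rewrite big_nil.
  exact: cvg_cst.
under eq_fun do rewrite big_cons.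
by have := cvgD (ui i) IH; rewrite addr0; exact.
Qed.

Context (zm z0 : nat -> seq R[i]).

(** zm and z0 stand for the final and the initial configurations. *)
Definition gap n f : R := average f (zm n) - average f (z0 n).

Lemma gapD n f g : gap n (fun a => f a + g a) = gap n f + gap n g.
Proof. by rewrite /gap !averageD; ring. Qed.

Lemma gap_le n f (s : R) : (forall a, `|f a| <= s) -> `|gap n f| <= 2 * s.
Proof.
move=> fs; apply: (le_trans (ler_normB _ _)).
by have := average_le (zm n) fs; have := average_le (z0 n) fs; lra.
Qed.

Lemma gap_ge0_le n f (s : R) : (forall a, 0 <= f a <= s) -> `|gap n f| <= s.
Proof.
move=> fs; have f0 a : 0 <= f a by have /andP[] := fs a.
have fs' a : `|f a| <= s by have /andP[f0' ?] := fs a; rewrite ger0_norm.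
have h1 := average_le (zm n) fs'; have h2 := average_le (z0 n) fs'.
have h3 := average_ge0 (zm n) f0; have h4 := average_ge0 (z0 n) f0.
rewrite ger0_norm// in h1; rewrite ger0_norm// in h2.
by rewrite /gap ler_norml; apply/andP; split; lra.
Qed.

Hypothesis gap_bump : forall p q s : rat, 0 < s ->
  gap n (disc_bump (Complex (ratr p) (ratr q)) (ratr s)) @[n --> \oo] --> (0 : R).

Lemma gap_lattice_sum (k N : nat) F :
  gap n (fun a => kappa * lattice_sum k.+1%:R^-1 N F a) @[n --> \oo] --> (0 : R).
Proof.
pose c u v : R[i] := lattice_point k.+1%:R^-1 N u v.
have -> : (fun n => gap n (fun a => kappa * lattice_sum k.+1%:R^-1 N F a)) =
    (fun n => \sum_(u < N.*2.+1) \sum_(v < N.*2.+1)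
      (kappa * F (c u v)) * gap n (disc_bump (c u v) (2 * k.+1%:R^-1))).
  apply/funext => n; rewrite /gap !averageZ -mulrBr /lattice_sum !average_sum -sumrB mulr_sumr.
  apply: eq_bigr => u _; rewrite !average_sum -sumrB mulr_sumr.
  by apply: eq_bigr => v _; rewrite !averageZ -mulrBr mulrA.
apply: cvg0_sum => u; apply: cvg0_sum => v.
rewrite -(mulr0 (kappa * F (c u v))); apply: cvgM; first exact: cvg_cst.
have := @gap_bump ((u%:R - N%:R) / k.+1%:R) ((v%:R - N%:R) / k.+1%:R) (2 / k.+1%:R).
rewrite /c /lattice_point !rmorphM !rmorphB /= !fmorphV /= !ratr_nat; apply.
by rewrite divr_gt0.
Qed.

(** One lattice sum, whose gap tends to 0, takes away from F a fixed proportion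
    of its supremum, up to a small error.  The positive part of the remainder
    is again uniformly continuous with bounded support, so that the argument
    can be iterated.  This avoids having to build lattices whose sum is almost
    constant. *)
Lemma gap_iterate (k : nat) F (s L e : R) : unif_cont F -> (forall a, 0 <= F a <= s) ->
  (forall a, F a != 0 -> `|complex.Re a| <= L /\ `|complex.Im a| <= L) -> 0 < e ->
  \forall n \near \oo, `|gap n F| <= (1 - 81%:R^-1) ^+ k * s + e.
Proof.
elim: k F s L e => [|k IH] F s L e uF Fs FL e0.
  apply: nearW => n; rewrite expr0 mul1r; apply: (le_trans (gap_ge0_le n Fs)).
  by rewrite lerDl ltW.
have e4 : 0 < e / 8 by rewrite divr_gt0.
have [k' [N [H1 H2]]] := lattice_approx uF Fs FL e4.
pose g a := kappa * lattice_sum k'.+1%:R^-1 N F a.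
have {}H1 a : - (e / 8) <= F a - g a <= (1 - 81%:R^-1) * s + e / 8 by exact: H1.
have ug : unif_cont g.
  have h0 : 0 < 2 * k'.+1%:R^-1 :> R by rewrite mulr_gt0.
  pose G : R := \sum_(u < N.*2.+1) \sum_(v < N.*2.+1)
    `|kappa * F (lattice_point k'.+1%:R^-1 N u v)| * (2 * (2 * k'.+1%:R^-1)^-1).
  apply: (@lipschitz_unif_cont _ _ G) => a b.
  rewrite /g -mulrBr /lattice_sum -sumrB mulr_sumr /G mulr_suml.
  apply: (le_trans (ler_norm_sum _ _ _)); apply: ler_sum => u _.
  rewrite -sumrB mulr_sumr mulr_suml.
  apply: (le_trans (ler_norm_sum _ _ _)); apply: ler_sum => v _.
  rewrite -mulrBr mulrA normrM -mulrA ler_wpM2l//.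
  exact: disc_bump_lipschitz.
pose F1 a := Num.max (F a - g a) 0.
have t0 : 0 <= 1 - 81%:R^-1 :> R by lra.
have s0 : 0 <= s by have /andP[? ?] := Fs 0; lra.
have uF1 : unif_cont F1 by apply: unif_cont_max0; exact: unif_contB.
have F1s a : 0 <= F1 a <= (1 - 81%:R^-1) * s + e / 8.
  have /andP[h1 h2] := H1 a.
  rewrite le_max lexx orbT /= ge_max h2 /=.
  by rewrite addr_ge0 ?(ltW e4)// mulr_ge0.
have F1L a : F1 a != 0 -> `|complex.Re a| <= L + 1 /\ `|complex.Im a| <= L + 1.
  move=> F1a; have [ga|ga] := eqVneq (g a) 0; last exact: H2.
  have [Fa|Fa] := eqVneq (F a) 0.
    by move: F1a; rewrite /F1 ga Fa subr0 maxxx eqxx.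
  by have [h1 h2] := FL _ Fa; split; lra.
have rest a : `|F a - g a - F1 a| <= e / 8.
  have /andP[h1 h2] := H1 a; rewrite /F1 ler_norml.
  by case: (leP (F a - g a) 0) => h; apply/andP; split; lra.
have IH1 := IH F1 _ _ _ uF1 F1s F1L e4.
have gg := @gap_lattice_sum k' N F.
move/cvgr0Pnorm_le in gg; have {}gg := gg _ e4.
near=> n.
have FE : F = fun a => g a + (F1 a + (F a - g a - F1 a)) by apply/funext => a; ring.
have -> : gap n F = gap n g + (gap n F1 + gap n (fun a => F a - g a - F1 a)).
  by rewrite {1}FE !gapD.
have h1 : `|gap n g| <= e / 8 by near: n.
have h2 : `|gap n F1| <= (1 - 81%:R^-1) ^+ k * ((1 - 81%:R^-1) * s + e / 8) + e / 8.
  by near: n.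
have h3 := gap_le n rest.
have tk : (1 - 81%:R^-1) ^+ k * (e / 8) <= e / 8 :> R.
  rewrite ler_piMl ?(ltW e4)// exprn_ile1//; lra.
rewrite mulrDr mulrA -exprSr in h2.
apply: (le_trans (ler_normD _ _)).
have h4 := ler_normD (gap n F1) (gap n (fun a => F a - g a - F1 a)).
lra.
Unshelve. all: by end_near.
Qed.

Lemma gap_supported F (s L : R) : unif_cont F -> (forall a, 0 <= F a <= s) ->
  (forall a, F a != 0 -> `|complex.Re a| <= L /\ `|complex.Im a| <= L) ->
  gap n F @[n --> \oo] --> (0 : R).
Proof.
move=> uF Fs FL; apply/cvgr0Pnorm_le => e e0.
have s0 : 0 <= s by have /andP[? ?] := Fs 0; lra.
have e20 : 0 < e / 2 by rewrite divr_gt0.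
have [k hk] : exists k, (1 - 81%:R^-1) ^+ k * s <= e / 2.
  have : ((1 - 81%:R^-1) ^+ k * s) @[k --> \oo] --> (0 * s : R).
    apply: cvgM; last exact: cvg_cst.
    by apply: cvg_expr; rewrite ger0_norm; lra.
  rewrite mul0r => /cvgr0Pnorm_le/(_ _ e20)[k _ /(_ k (leqnn k)) /= h].
  by exists k; apply: le_trans h; exact: ler_norm.
apply: filterS (gap_iterate k uF Fs FL e20) => n h.
by apply: (le_trans h); lra.
Qed.

End Averages.

(** * Weak convergence *)

Section EmpiricalMeasure.
Context {R : realType}.
Implicit Types (z : seq R[i]).
Local Notation nc := (@Normc.normc R).

Lemma integral_empirical_measure z (f : R[i]^o -> R) : continuous f ->
  (\int[empirical_measure z]_x (f x)%:E = (average f z)%:E)%E.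
Proof.
move=> cf; have mf := continuous_borelC_measurable cf.
have key (g : borelC R -> R) : measurable_fun setT g -> (forall x, 0 <= g x) ->
    (\int[empirical_measure z]_x (g x)%:E = (average (g : R[i] -> R) z)%:E)%E.
  move=> mg g0; have mEg : measurable_fun setT (EFin \o g) by exact/measurable_EFinP.
  rewrite /empirical_measure ge0_integral_mscale//=.
  rewrite ge0_integral_measure_sum//=.
  under eq_bigr do rewrite integral_dirac// diracT mul1e.
  + rewrite sumEFin -EFinM /average mulrC; congr (_ * _)%:E.
    by rewrite (big_nth 0) big_mkord.
  + by move=> x _; rewrite lee_fin.
  + by move=> x _; rewrite lee_fin.
rewrite integralE.
have -> : (fun x : borelC R => (f x)%:E)^\+%E = (fun x : borelC R => (Num.max (f x) 0)%:E).
  by apply/funext => x; rewrite funeposE EFin_max.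
have -> : (fun x : borelC R => (f x)%:E)^\-%E = (fun x : borelC R => (Num.max (- f x) 0)%:E).
  by apply/funext => x; rewrite funenegE EFin_max.
rewrite !key.
- rewrite -EFinB /average -mulrBl -sumrB; congr (_ / _)%:E.
  by apply: eq_bigr => x _; case: (leP (f x) 0) => h; case: (leP (- f x) 0) => h'; lra.
- by apply: measurable_maxr => //; exact: measurableT_comp.
- by move=> x; rewrite le_max lexx orbT.
- exact: measurable_maxr.
- by move=> x; rewrite le_max lexx orbT.
Qed.

End EmpiricalMeasure.

Section Conclusion.
Context {R : realType}.
Local Notation nc := (@Normc.normc R).
Context (m : nat -> nat) (zm z0 : nat -> seq R[i]).
Hypothesis m_bounds : forall n, (2 <= n)%N -> (1 <= m n <= n - 1)%N.
Hypothesis m_small : (m n)%:R / (n%:R / ln n%:R) @[n --> \oo] --> (0 : R).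
Hypothesis size_zm : forall n, size (zm n) = (n - m n)%N.
Hypothesis size_z0 : forall n, size (z0 n) = n.

(** A gap between averages is a gap between sums, of order m log n by
    assumption, plus the effect of the m missing points; both are o(n). *)
Lemma gap_bump_cvg (c : R[i]) (r K1 K2 : R) : 0 < r ->
  (exists N, forall n, (N <= n)%N ->
    `|\sum_(a <- zm n) logmax c (2 * r) a - \sum_(a <- z0 n) logmax c (2 * r) a|
      <= (m n)%:R * (K1 * ln n%:R)) ->
  (exists N, forall n, (N <= n)%N ->
    `|\sum_(a <- zm n) logmax c r a - \sum_(a <- z0 n) logmax c r a|
      <= (m n)%:R * (K2 * ln n%:R)) ->
  gap zm z0 n (disc_bump c r) @[n --> \oo] --> (0 : R).
Proof.
move=> r0 [N1 H1] [N2 H2]; apply/cvgr0Pnorm_le => e e0.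
pose K := 1 + `|K1| + `|K2|; have K0 : 0 < K.
  by have := normr_ge0 K1; have := normr_ge0 K2; rewrite /K; lra.
have eK : 0 < e / K by rewrite divr_gt0.
move/cvgr0Pnorm_le : m_small => /(_ _ eK)[N3 _ H3].
exists (maxn 2 (maxn N1 (maxn N2 N3))) => //= n /=.
rewrite !geq_max => /andP[n2 /andP[/H1 h1 /andP[/H2 h2 /H3 h3]]].
have /andP[_ mn] := m_bounds n2.
have n0 : 0 < n%:R :> R by rewrite ltr0n ltnW.
have mn' : (m n < n)%N by lia.
have l2 : 0 < ln 2 :> R by rewrite ln_gt0// ltr1n.
have l2n : ln 2 <= ln n%:R :> R by rewrite ler_ln ?posrE// ler_nat.
set A := average (disc_bump c r) (zm n).
have A1 : 0 <= A <= ln 2.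
  rewrite average_ge0 => [/=|a]; last exact: disc_bump_ge0.
  apply: (le_trans (ler_norm _)); apply: average_le => a.
  by rewrite ger0_norm ?disc_bump_ge0 ?disc_bump_le.
pose S := \sum_(a <- zm n) disc_bump c r a.
pose S' := \sum_(a <- z0 n) disc_bump c r a.
have -> : gap zm z0 n (disc_bump c r) = A * ((m n)%:R / n%:R) + (S - S') / n%:R.
  rewrite /gap /A /average -/S -/S' size_zm size_z0.
  have nm : (n - m n)%:R != 0 :> R by rewrite pnatr_eq0 subn_eq0 -ltnNge.
  have -> : (m n)%:R = n%:R - (n - m n)%:R :> R by rewrite natrB ?(ltnW mn')//; ring.
  by field; rewrite nm gt_eqF.
have SS : `|S - S'| <= (m n)%:R * ((`|K1| + `|K2|) * ln n%:R).
  rewrite /S /S' /disc_bump !sumrB.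
  set a1 := \sum_(a <- zm n) logmax c (2 * r) a in h1 *.
  set a2 := \sum_(a <- z0 n) logmax c (2 * r) a in h1 *.
  set a3 := \sum_(a <- zm n) logmax c r a in h2 *.
  set a4 := \sum_(a <- z0 n) logmax c r a in h2 *.
  rewrite (_ : _ - _ = (a1 - a2) - (a3 - a4)); last by ring.
  apply: (le_trans (ler_normB _ _)); apply: (le_trans (lerD h1 h2)).
  rewrite -mulrDr -mulrDl ler_wpM2l// ler_wpM2r ?(le_trans (ltW l2))//.
  by apply: lerD; exact: ler_norm.
have h3' : (m n)%:R * ln n%:R / n%:R <= e / K.
  apply: le_trans h3; apply: le_trans (ler_norm _).
  by rewrite invf_div mulrA.
have mnn : 0 <= (m n)%:R / n%:R :> R by rewrite divr_ge0.
have /andP[A0 Al] := A1.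
have e1 : `|A * ((m n)%:R / n%:R)| = A * ((m n)%:R / n%:R) by rewrite ger0_norm// mulr_ge0.
have e2 : `|(S - S') / n%:R| = `|S - S'| / n%:R by rewrite normrM normfV (gtr0_norm n0).
apply: (le_trans (ler_normD _ _)); rewrite e1 e2.
apply: (@le_trans _ _ (ln n%:R * ((m n)%:R / n%:R) +
   (m n)%:R * ((`|K1| + `|K2|) * ln n%:R) / n%:R)).
  apply: lerD; first by rewrite ler_wpM2r// (le_trans Al).
  by rewrite ler_wpM2r// invr_ge0 ltW.
have -> : ln n%:R * ((m n)%:R / n%:R) +
   (m n)%:R * ((`|K1| + `|K2|) * ln n%:R) / n%:R = K * ((m n)%:R * ln n%:R / n%:R).
  by rewrite /K; ring.
by rewrite mulrC -ler_pdivlMr.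
Qed.

Hypothesis gap_bump : forall p q s : rat, 0 < s ->
  gap zm z0 n (disc_bump (Complex (ratr p) (ratr q)) (ratr s)) @[n --> \oo] --> (0 : R).
Context (mu : {measure set (borelC R) -> \bar R}).
Hypothesis cvg_z0 : cvg_weakly (fun n => empirical_measure (z0 n)) mu.

Lemma average_cst (k : R) z : (0 < size z)%N -> average (fun=> k : R) z = k.
Proof.
move=> z0'; rewrite /average big_const_seq count_predT iter_addr_0 -[X in X / _]mulr_natr.
by rewrite mulfK// pnatr_eq0 -lt0n.
Qed.

Lemma weak_limit_mass : mu setT = 1%E.
Proof.
have h : (\int[empirical_measure (z0 n)]_x (cst 1%R x : R)%:E)%E @[n --> \oo] -->
    (\int[mu]_x (cst 1%R x : R)%:E)%E.
  apply: cvg_z0; first exact: cst_continuous.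
  by exists 1 => x; rewrite normr1.
have h' : (\int[empirical_measure (z0 n)]_x (cst 1%R x : R)%:E)%E @[n --> \oo] --> 1%E.
  apply: cvg_near_cst; exists 1%N => // n /= n1.
  rewrite integral_empirical_measure; last exact: cst_continuous.
  by rewrite average_cst// size_z0.
have := cvg_unique (@ereal_hausdorff R) h h'.
by move=> E; rewrite -[LHS]mul1e -integral_cst//; exact: E.
Qed.

(** Being a multiple of a bump, the cutoff has a gap that tends to 0: tightness
    passes from the initial configurations to the final ones. *)
Definition cutoff (A : nat) (a : R[i]) : R := (ln 2)^-1 * disc_bump 0 A.+1%:R a.

Lemma cutoff_bounds A a : 0 <= cutoff A a <= 1.
Proof.
have l2 : 0 < ln 2 :> R by rewrite ln_gt0// ltr1n.
rewrite mulr_ge0 ?invr_ge0 ?(ltW l2) ?disc_bump_ge0//=.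
by rewrite /cutoff mulrC ler_pdivrMr// mul1r disc_bump_le.
Qed.

Lemma cutoff_lipschitz A a b :
  `|cutoff A a - cutoff A b| <= (ln 2)^-1 * (2 * A.+1%:R^-1) * nc (a - b).
Proof.
have l2 : 0 < ln 2 :> R by rewrite ln_gt0// ltr1n.
rewrite /cutoff -mulrBr normrM gtr0_norm ?invr_gt0// -[leRHS]mulrA ler_pM2l ?invr_gt0//.
exact: disc_bump_lipschitz.
Qed.

Lemma cutoff_continuous A : continuous (cutoff A : R[i]^o -> R).
Proof. exact: lipschitz_continuous (cutoff_lipschitz A). Qed.

Lemma gap_cutoff A : gap zm z0 n (cutoff A) @[n --> \oo] --> (0 : R).
Proof.
have -> : (fun n => gap zm z0 n (cutoff A)) =
    (fun n => (ln 2)^-1 * gap zm z0 n (disc_bump 0 A.+1%:R)).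
  by apply/funext => n; rewrite /gap /cutoff !averageZ mulrBr.
rewrite -(mulr0 (ln 2)^-1); apply: cvgM; first exact: cvg_cst.
by have := @gap_bump 0 0 A.+1%:R; rewrite !rmorph0 ratr_nat; apply.
Qed.

Lemma cutoff_integral_ge (e : R) : 0 < e ->
  exists A, ((1 - e)%:E < \int[mu]_x (cutoff A x)%:E)%E.
Proof.
move=> e0; have l2 : 0 < ln 2 :> R by rewrite ln_gt0// ltr1n.
pose B k : set (borelC R) := [set a : R[i] | nc a <= k%:R].
have mB k : measurable (B k).
  have := @measurable_modulus R measurableT `]-oo, k%:R]%classic (measurable_itv _).
  rewrite setTI; congr (measurable _); apply/seteqP; split => a /=;
    by rewrite in_itv.
have ndB : nondecreasing_seq B.
  move=> k l kl; apply/subsetPset => a h.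
  by apply: (le_trans h); rewrite ler_nat.
have BT : \bigcup_k B k = setT.
  apply/seteqP; split => // a _; exists (Num.trunc (nc a)).+1 => //=.
  exact/ltW/truncnS_gt.
have cB : (mu \o B) k @[k --> \oo] --> mu (\bigcup_k B k).
  by apply: nondecreasing_cvg_mu => //; exact: bigcup_measurable.
rewrite BT weak_limit_mass in cB.
have lt1 : ((1 - e)%:E < 1)%E by rewrite lte_fin; lra.
have [k _ /(_ k (leqnn k)) /= hk] := cB _ (open_ereal_gt' lt1).
exists k; apply: (lt_le_trans hk).
have mc : measurable_fun setT (cutoff k : borelC R -> R).
  by apply: continuous_borelC_measurable; exact: cutoff_continuous.
apply: (@le_trans _ _ (\int[mu]_(x in B k) (cutoff k x)%:E)%E).
  rewrite -[leLHS]mul1e -integral_cst//; apply: ge0_le_integral => //.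
  - by apply/measurable_EFinP; exact: measurable_funTS.
  - move=> a /= ak; rewrite lee_fin /cutoff disc_bump_near// ?mulVf ?gt_eqF//.
    by rewrite subr0 (le_trans ak)// ler_nat.
apply: ge0_subset_integral => //; first exact/measurable_EFinP.
by move=> a _; rewrite lee_fin; have /andP[] := cutoff_bounds k a.
Qed.

Lemma cutoff_support A a : cutoff A a != 0 ->
  `|complex.Re a| <= 2 * A.+1%:R /\ `|complex.Im a| <= 2 * A.+1%:R.
Proof.
move=> ca; have ha : nc a <= 2 * A.+1%:R.
  rewrite leNgt; apply: contra ca => h.
  by rewrite /cutoff disc_bump_far ?mulr0// subr0 ltW.
by split; apply: le_trans ha; [exact: le_Re_modulus|exact: le_Im_modulus].
Qed.

Lemma unif_cont_mul_cutoff (f : R[i]^o -> R) (s : R) A : continuous f ->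
  (forall a, 0 <= f a <= s) -> unif_cont (fun a => f a * cutoff A a).
Proof.
move=> cf fs e e0; set L : R := 2 * A.+1%:R.
have s0 : 0 <= s by have /andP[? ?] := fs 0; lra.
have e20 : 0 < e / 2 by rewrite divr_gt0.
have [d1 d10 H1] := unif_continuous_square (L + 1) cf e20.
have s1 : 0 < s + 1 by lra.
have es : 0 < e / 2 / (s + 1) by rewrite divr_gt0.
have [d2 d20 H2] := lipschitz_unif_cont (cutoff_lipschitz A) es.
(* the distance 1 separates the support of the cutoff from the outside of the
   square where f is uniformly continuous *)
exists (Num.min (Num.min d1 d2) 1); first by rewrite !lt_min d10 d20 ltr01.
move=> a b; rewrite !lt_min => /andP[/andP[ab1 ab2] ab].
have [/andP[fa0 fas] /andP[ca0 ca1]] := (fs a, cutoff_bounds A a).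
have [/andP[fb0 fbs] /andP[cb0 cb1]] := (fs b, cutoff_bounds A b).
have [/andP[ra ia]|out] := boolP ((`|complex.Re a| <= L + 1) && (`|complex.Im a| <= L + 1)).
  have h1 := H1 a b ra ia ab1; have h2 := H2 a b ab2.
  have -> : f a * cutoff A a - f b * cutoff A b =
    (f a - f b) * cutoff A a + f b * (cutoff A a - cutoff A b) by ring.
  have E1 : `|(f a - f b) * cutoff A a| = `|f a - f b| * cutoff A a.
    by rewrite (normrM (f a - f b)) (ger0_norm ca0).
  have E2 : `|f b * (cutoff A a - cutoff A b)| = f b * `|cutoff A a - cutoff A b|.
    by rewrite (normrM (f b)) (ger0_norm fb0).
  apply: (le_lt_trans (ler_normD _ _)); rewrite E1 E2.
  have h3 : `|f a - f b| * cutoff A a <= `|f a - f b| by rewrite ler_piMr.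
  have h4 : f b * `|cutoff A a - cutoff A b| <= s * (e / 2 / (s + 1)).
    by apply: ler_pM => //; exact: ltW.
  have h5 : s * (e / 2 / (s + 1)) <= e / 2.
    by rewrite mulrCA ler_piMr ?(ltW e20)// ler_pdivrMr// mul1r; lra.
  lra.
have hr := le_Re_modulus (a - b); have hi := le_Im_modulus (a - b).
rewrite raddfB /= in hr; rewrite raddfB /= in hi.
have t1 := ler_normD (complex.Re a - complex.Re b) (complex.Re b).
have t2 := ler_normD (complex.Im a - complex.Im b) (complex.Im b).
rewrite subrK in t1; rewrite subrK in t2.
have -> : cutoff A a = 0.
  apply/eqP; apply: contraNT out => /cutoff_support; rewrite -/L => -[? ?].
  by apply/andP; split; lra.
have -> : cutoff A b = 0.
  apply/eqP; apply: contraNT out => /cutoff_support; rewrite -/L => -[? ?].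
  by apply/andP; split; lra.
by rewrite !mulr0 subr0 normr0.
Qed.

Lemma average_mulB_cutoff_le (f : R[i] -> R) (s : R) A z : (0 < size z)%N ->
  (forall a, 0 <= f a <= s) ->
  0 <= average (fun a => f a * (1 - cutoff A a)) z <= s * (1 - average (cutoff A) z).
Proof.
move=> sz fs.
have c1 a : 0 <= 1 - cutoff A a by have /andP[? ?] := cutoff_bounds A a; lra.
rewrite average_ge0 => [/=|a]; last first.
  by rewrite mulr_ge0//; have /andP[] := fs a.
have -> : s * (1 - average (cutoff A) z) = average (fun a => s * (1 + -1 * cutoff A a)) z.
  by rewrite (averageZ s) averageD (averageZ (- 1)) average_cst// mulN1r.
rewrite /average ler_wpM2r ?invr_ge0//; apply: ler_sum => a _.
by rewrite mulN1r ler_wpM2r//; have /andP[] := fs a.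
Qed.

(** f is split into f * cutoff, which is uniformly continuous with bounded
    support, and f * (1 - cutoff), whose averages are small: for the initial
    configurations because mu has mass 1, for the final ones because the gap
    of the cutoff is small. *)
Lemma gap_ge0_bounded (f : R[i]^o -> R) (s : R) : continuous f ->
  (forall a, 0 <= f a <= s) -> gap zm z0 n f @[n --> \oo] --> (0 : R).
Proof.
move=> cf fs; apply/cvgr0Pnorm_le => e e0.
have s0 : 0 <= s by have /andP[? ?] := fs 0; lra.
have s1 : 0 < s + 1 by lra.
have e20 : 0 < e / 2 by rewrite divr_gt0.
pose eta := e / 6 / (s + 1); have eta0 : 0 < eta by rewrite !divr_gt0.
have seta : s * eta <= e / 6.
  by rewrite /eta mulrCA ler_piMr ?divr_ge0 ?(ltW e0)// ler_pdivrMr// mul1r; lra.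
have [A HA] := cutoff_integral_ge eta0.
have gA := gap_cutoff A; move/cvgr0Pnorm_le in gA; have {}gA := gA _ eta0.
have gf : gap zm z0 n (fun a => f a * cutoff A a) @[n --> \oo] --> (0 : R).
  apply: (gap_supported gap_bump (s := s) (L := 2 * A.+1%:R)).
  - exact: unif_cont_mul_cutoff fs.
  - move=> a; have /andP[h1 h2] := fs a; have /andP[h3 h4] := cutoff_bounds A a.
    by rewrite mulr_ge0//= -[leRHS]mulr1 ler_pM.
  - by move=> a; rewrite mulf_eq0 negb_or => /andP[_]; exact: cutoff_support.
move/cvgr0Pnorm_le in gf; have {}gf := gf _ e20.
have lim0 : (\int[empirical_measure (z0 n)]_x (cutoff A x)%:E)%E @[n --> \oo] -->
    (\int[mu]_x (cutoff A x)%:E)%E.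
  apply: cvg_z0; first exact: cutoff_continuous.
  by exists 1 => x; have /andP[h1 h2] := cutoff_bounds A x; rewrite ger0_norm.
have {}lim0 := lim0 _ (open_ereal_gt' HA).
have n2 : \forall n \near \oo, (2 <= n)%N by exists 2%N.
near=> n.
have nn : (2 <= n)%N by near: n.
have l0 : ((1 - eta)%:E < \int[empirical_measure (z0 n)]_x (cutoff A x)%:E)%E by near: n.
rewrite integral_empirical_measure ?lte_fin in l0; last exact: cutoff_continuous.
have l1 : `|gap zm z0 n (cutoff A)| <= eta by near: n.
have l2 : `|gap zm z0 n (fun a => f a * cutoff A a)| <= e / 2 by near: n.
have sz0 : (0 < size (z0 n))%N by rewrite size_z0 ltnW.
have szm : (0 < size (zm n))%N.
  by rewrite size_zm; have := m_bounds nn; lia.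
have /andP[p1 p2] := average_mulB_cutoff_le A sz0 fs.
have /andP[q1 q2] := average_mulB_cutoff_le A szm fs.
have FE : f = (fun a => f a * cutoff A a + f a * (1 - cutoff A a)) :> (R[i] -> R).
  by apply/funext => a; ring.
rewrite FE gapD; set g1 := gap _ _ _ _ in l2 *.
move: l1; rewrite {1}/gap ler_norml => /andP[l3 l4].
have m0 : s * (1 - average (cutoff A) (z0 n)) <= s * eta by rewrite ler_wpM2l//; lra.
have mm : s * (1 - average (cutoff A) (zm n)) <= s * (2 * eta) by rewrite ler_wpM2l//; lra.
move: l2; rewrite /gap !ler_norml => /andP[l5 l6].
apply/andP; split; lra.
Unshelve. all: by end_near.
Qed.

Lemma cvg_weakly_zm : cvg_weakly (fun n => empirical_measure (zm n)) mu.
Proof.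
move=> f cf fM; have lim0 := cvg_z0 cf fM; case: fM => M fM.
have g0 : gap zm z0 n (fun a => f a + M) @[n --> \oo] --> (0 : R).
  apply: (@gap_ge0_bounded (fun a => f a + M) (M + M)) => a.
    apply: (@continuous_comp _ _ _ f (fun y : R => y + M)); first exact: cf.
    by apply: cvgD; [exact: cvg_id|exact: cvg_cst].
  by have := fM a; rewrite ler_norml => /andP[? ?]; apply/andP; split; lra.
have {}g0 : gap zm z0 n f @[n --> \oo] --> (0 : R).
  apply: cvg_trans g0; apply: near_eq_cvg; exists 2%N => // n /= n2.
  rewrite gapD; have -> : gap zm z0 n (fun=> M) = 0; last by rewrite addr0.
  rewrite /gap !average_cst ?subrr ?size_z0 ?size_zm ?(ltnW n2)//.
  by have := m_bounds n2; lia.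
have -> : (fun n => \int[empirical_measure (zm n)]_x (f x)%:E)%E =
    (fun n => \int[empirical_measure (z0 n)]_x (f x)%:E + (gap zm z0 n f)%:E)%E.
  apply/funext => n; rewrite !integral_empirical_measure//.
  by rewrite -EFinD /gap addrC subrK.
rewrite -[X in _ --> X]adde0; apply: cvgeD => //.
  by rewrite fin_num_adde_defl.
by apply/fine_cvgP; split; [exact: nearW|exact: g0].
Qed.

End Conclusion.

Lemma ae_forall_countable d (T : measurableType d) (R : realType)
    (mu : {measure set T -> \bar R}) (I : countType) (Q : I -> T -> Prop) :
  (forall i, {ae mu, forall w, Q i w}) -> {ae mu, forall w, forall i, Q i w}.
Proof.
move=> H.
have : {ae mu, forall w, forall n, if choice.unpickle n is Some i then Q i w else True}.
  apply: ae_foralln => n; case: choice.unpickle => [i|]; first exact: H.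
  exact: aeW.
by apply: filterS => w h i; have := h (choice.pickle i); rewrite choice.pickleK.
Qed.

Theorem theorem2 (R : realType) (d : measure_display)
    (Omega : measurableType d) (P : probability Omega R)
    (beta : R) (m : nat -> nat)
    (gamma : forall n j, Omega -> (n.+1 - j).-tuple R)
    (Z : forall n j, Omega -> (n - j).-tuple (borelC R))
    (mu : {measure set (borelC R) -> \bar R}) (B : R)
    (beta_gt0 : 0 < beta)
    (m_bounds : forall n, (2 <= n)%N -> (1 <= m n <= n - 1)%N)
    (Z_gamma : iterated_randomized_derivatives P beta m gamma Z)
    (cvg_mu0 : {ae P, forall w,
       cvg_weakly (fun n => empirical_measure (Z n 0%N w)) mu})
    (m_small : (m n)%:R / (n%:R / ln n%:R) @[n --> \oo] --> (0 : R))
    (B_ge0 : 0 <= B)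
    (moment_bound : (ereal_sup
       [set (n%:R `^ (- B))%:E *
            ereal_sup [set 'E_P[fun w => min_modulus (Z n j w)]
                      | j in [set j | (j <= m n - 1)%N]]
       | n in [set n | (2 <= n)%N]] < +oo)%E) :
  {ae P, forall w,
    cvg_weakly (fun n => empirical_measure (Z n (m n) w)) mu}.
Proof.
have [M M0 EM] := moment_bound_real moment_bound.
pose logsum (p q s : rat) n j w : R :=
  \sum_(a <- Z n j w) logmax (Complex (ratr p) (ratr q)) (ratr s) a.
have sums (p q s : rat) : 0 < s -> exists K : R, {ae P, forall w, exists N,
    forall n, (N <= n)%N ->
    `|logsum p q s n (m n) w - logsum p q s n 0%N w| <= (m n)%:R * (K * ln n%:R)}.
  move=> s0; have r0 : 0 < ratr s :> R by rewrite ltr0q.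
  exact: (logmax_sums_close beta_gt0 Z_gamma m_bounds (Complex (ratr p) (ratr q)) r0 M0 EM).
have bumps : {ae P, forall w, forall t : rat * rat * rat, 0 < t.2 ->
    gap (fun n => Z n (m n) w) (fun n => Z n 0%N w) n
      (disc_bump (Complex (ratr t.1.1) (ratr t.1.2)) (ratr t.2)) @[n --> \oo] --> (0 : R)}.
  apply: ae_forall_countable => -[[p q] s] /=.
  have [s0|s0] := ltP 0 s; last by apply: aeW => w.
  have s20 : 0 < 2 * s by rewrite mulr_gt0.
  have [K1 H1] := sums p q (2 * s) s20; have [K2 H2] := sums p q s s0.
  apply: filterS2 H1 H2 => w H1 H2 _.
  apply: (gap_bump_cvg m_bounds m_small _ _ _ (K1 := K1) (K2 := K2)) => //.
  - by move=> n; rewrite size_tuple.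
  - by move=> n; rewrite size_tuple subn0.
  - by rewrite ltr0q.
  - by move: H1; rewrite /logsum rmorphM /= ratr_nat.
apply: filterS2 bumps cvg_mu0 => w bw cw.
apply: (cvg_weakly_zm m_bounds _ _ _ cw).
- by move=> n; rewrite size_tuple.
- by move=> n; rewrite size_tuple subn0.
- by move=> p q s s0; exact: (bw (p, q, s)).
Qed.
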